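(* Let $g(x)=e^{-x^2}$ and let $\Lambda\subset\mathbb{R}^2$ be a lattice of rational density $<1$. Then for every $(u,\eta)\in\mathbb{R}^2\setminus\Lambda$ the function $x\mapsto e^{2\pi i\eta x}g(x-u)$ does not belong to $\mathcal{G}(g,\Lambda)$.
   Context: A lattice in $\mathbb{R}^2$ is a set of the form $\Lambda=A\mathbb{Z}^2$ with $A\in\mathrm{GL}(2,\mathbb{R})$; its density is $|\det A|^{-1}$. $\mathcal{G}(g,\Lambda)$ denotes the closed linear span in $L^2(\mathbb{R})$ (complex-valued functions) of the functions $x\mapsto e^{2\pi i b x}g(x-a)$, $(a,b)\in\Lambda$. *)

(* Defs.v *)
From HB Require Import structures.
From mathcomp Require Import all_boot all_order all_algebra.
From mathcomp Require Import complex.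
From mathcomp Require Import all_classical all_reals all_analysis.

Set Implicit Arguments.
Unset Strict Implicit.
Unset Printing Implicit Defensive.
Import Order.TTheory GRing.Theory Num.Theory.
Import numFieldNormedType.Exports.
Local Open Scope classical_set_scope.
Local Open Scope ring_scope.
Local Open Scope complex_scope.

Definition lattice (R : realType) (A : 'M[R]_2) : set 'cV[R]_2 :=
  [set A *m map_mx intr z | z in [set: 'cV[int]_2]].

Definition density (R : realType) (A : 'M[R]_2) : R := `|\det A|^-1.

(* Elements of L^2(R) are represented by Borel measurable functions rather than
   by classes: among such functions, membership in [L2] and in [closed_span]
   is invariant under almost-everywhere equality. *)
Definition L2norm (R : realType) (f : R -> R[i]) : \bar R :=
  'N[@lebesgue_measure R]_2%:E[EFin \o (fun x => ComplexField.Normc.normc (f x))]%E.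

Definition L2 (R : realType) : set (R -> R[i]) :=
  [set f | [/\ measurable_fun [set: R] (fun x => complex.Re (f x)),
               measurable_fun [set: R] (fun x => complex.Im (f x)) &
               (L2norm f < +oo)%E]].

Definition linear_span (R : realType) (S : set (R -> R[i])) :
    set (R -> R[i]) :=
  [set h | exists (n : nat) (c : 'I_n -> R[i]) (phi : 'I_n -> R -> R[i]),
     (forall k, S (phi k)) /\ h = (fun x => \sum_(k < n) c k * phi k x)].

Definition closed_span (R : realType) (S : set (R -> R[i])) :
    set (R -> R[i]) :=
  [set f | L2 f /\ forall eps : R, 0 < eps ->
     exists2 h, linear_span S h & (L2norm (f \- h)%R < eps%:E)%E].

Definition expi (R : realType) (t : R) : R[i] := cos t +i* sin t.

Definition tf_shift (R : realType) (a b : R) (g : R -> R[i]) : R -> R[i] :=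
  fun x => expi (2 * pi * b * x) * g (x - a).

Definition gabor_space (R : realType) (g : R -> R[i]) (L : set 'cV[R]_2) :
    set (R -> R[i]) :=
  closed_span [set tf_shift (w 0 0) (w 1 0) g | w in L].

Definition gaussian (R : realType) : R -> R[i] :=
  fun x => (expR (- x ^+ 2))%:C.

(* Main.v *)
Require Import Defs.
From mathcomp Require Import all_boot all_order all_algebra.
From mathcomp Require Import complex.
From mathcomp Require Import all_classical all_reals all_analysis.
From mathcomp Require Import measurable_realfun.
From mathcomp Require Import ring lra zify.
Import Order.TTheory GRing.Theory Num.Theory.
Import numFieldNormedType.Exports.
Set Implicit Arguments.
Unset Strict Implicit.
Unset Printing Implicit Defensive.
Local Open Scope classical_set_scope.
Local Open Scope ring_scope.
Local Open Scope complex_scope.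

(** Write [phase a b = 2a + 2 pi i b] and let [(a1, b1)], [(a2, b2)] be a
    basis of the lattice with [a1 != 0] and determinant [D > 1]. Since the
    closed span contains the shift at [(u, eta)] only if every bounded
    functional that kills the lattice shifts also kills that shift, it is
    enough to exhibit suitable functionals. In the Bargmann picture such a
    functional is an entire function in Fock space that vanishes on the
    lattice and nowhere else, that is, a Weierstrass sigma function times a
    Gaussian; its growth is admissible because the density [1 / D] is smaller
    than 1. The proof below makes this explicit on the side of [L^2], where a
    theta series becomes a sum of Gaussians.

    Pair the shift at [(a, b)] with the windows
    [G_k(x) = exp (- alpha x^2 + k beta x)], [k] an integer. As [beta] is
    purely imaginary, all the [G_k] have the same norm. The product of the
    shift and [G_k] is a Gaussian with parameter [p = 1 + alpha], and
    [gaussian_integral] evaluates its integral as a nonzero factor independent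
    of [k] times [exp (k t + k^2 gamma)]. The slope of the chirp in [alpha] is
    chosen so that [p] is a real multiple of [phase a1 b1]; then
    [t = 2 pi i phase a b / phase a1 b1], so that [exp t] is 1 at [(a1, b1)]
    and equals [q], of modulus less than 1, at [(a2, b2)].

    Now weight the pairings with the coefficients of the finite Jacobi triple
    product [finite_jacobi_triple_product], divided by [exp (k^2 gamma)]. The
    resulting functional maps the shift at [(a, b)] to a nonzero factor times
    [prod_(m < N) (1 - q^m exp t) * prod_(m < N) (1 - q^(m+1) exp (- t))].
    This vanishes at the lattice points whose second coordinate is smaller
    than [N] in absolute value ([pairing_lattice]); off the lattice it stays
    away from 0 uniformly in [N] ([pairing_lower_bound]). The weights decay
    like [exp (- c k^2)], where [c] is positive because the real part [kappa]
    of [alpha] is smaller than [D - 1]; this is where [D > 1] enters. Hence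
    the functionals are bounded on [L^2] uniformly in [N] ([pairing_bounded]).
    A linear combination of lattice shifts involves only finitely many lattice
    points and is killed once [N] is large; its distance to the shift at a
    point off the lattice is therefore bounded below, independently of the
    combination.

    Working with finite products makes it unnecessary to sum or factor a theta
    series: every identity used is an identity between finite sums. *)

(** * The complex exponential *)

Notation normc := ComplexField.Normc.normc.
Notation Rec := complex.Re.
Notation Imc := complex.Im.

Section ComplexExp.
Variable R : realType.
Implicit Types (z w : R[i]) (x y : R).

Definition cexp z : R[i] :=
  (expR (Rec z) * cos (Imc z)) +i* (expR (Rec z) * sin (Imc z)).

Lemma RecD z w : Rec (z + w) = Rec z + Rec w.
Proof. by case: z; case: w. Qed.
Lemma ImcD z w : Imc (z + w) = Imc z + Imc w.
Proof. by case: z; case: w. Qed.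
Lemma RecN z : Rec (- z) = - Rec z.
Proof. by case: z. Qed.
Lemma ImcN z : Imc (- z) = - Imc z.
Proof. by case: z. Qed.
Lemma RecM z w : Rec (z * w) = Rec z * Rec w - Imc z * Imc w.
Proof. by case: z; case: w. Qed.
Lemma ImcM z w : Imc (z * w) = Rec z * Imc w + Imc z * Rec w.
Proof. by case: z; case: w. Qed.
Definition cE := (RecD, ImcD, RecN, ImcN, RecM, ImcM).

Lemma complex_ext z w : Rec z = Rec w -> Imc z = Imc w -> z = w.
Proof. by case: z => a b; case: w => c d /= -> ->. Qed.

Lemma Re_cexp z : Rec (cexp z) = expR (Rec z) * cos (Imc z).
Proof. by []. Qed.
Lemma Im_cexp z : Imc (cexp z) = expR (Rec z) * sin (Imc z).
Proof. by []. Qed.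

Lemma cexpE z : cexp z = (expR (Rec z))%:C * expi (Imc z).
Proof. by apply: complex_ext; rewrite cE /= mul0r ?subr0 ?addr0. Qed.

Lemma cexpD z w : cexp (z + w) = cexp z * cexp w.
Proof.
by apply: complex_ext; rewrite !cE !Re_cexp !Im_cexp !cE expRD (cosD, sinD); ring.
Qed.

Lemma cexp0 : cexp 0 = 1 :> R[i].
Proof.
by apply: complex_ext; rewrite ?Re_cexp ?Im_cexp /= expR0 ?cos0 ?sin0 mul1r.
Qed.

Lemma cexpVr z : cexp z * cexp (- z) = 1.
Proof. by rewrite -cexpD subrr cexp0. Qed.

Lemma cexp_neq0 z : cexp z != 0.
Proof.
by apply/eqP => h; move: (cexpVr z); rewrite h mul0r => /eqP; rewrite eq_sym oner_eq0.
Qed.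

Lemma cexpN z : cexp (- z) = (cexp z)^-1.
Proof.
by apply: (mulfI (cexp_neq0 z)); rewrite cexpVr divff // cexp_neq0.
Qed.

Lemma cexpMn z n : cexp (z *+ n) = cexp z ^+ n.
Proof.
elim: n => [|n IH]; first by rewrite mulr0n cexp0 expr0.
by rewrite mulrS cexpD IH exprS.
Qed.

Lemma normc_ge0 z : 0 <= normc z.
Proof. by case: z => a b; rewrite /= sqrtr_ge0. Qed.

Lemma normcR x : normc x%:C = `|x|.
Proof. by rewrite /= expr0n addr0 sqrtr_sqr. Qed.

Lemma normc_cexp z : normc (cexp z) = expR (Rec z).
Proof.
rewrite cexpE ComplexField.Normc.normcM normcR ger0_norm ?expR_ge0 //.
by rewrite /expi /= cos2Dsin2 sqrtr1 mulr1.
Qed.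

Lemma Re_le_normc z : `|Rec z| <= normc z.
Proof.
case: z => a b /=; rewrite -[leLHS]sqrtr_sqr ler_sqrt.
  by rewrite lerDl sqr_ge0.
by rewrite addr_ge0 ?sqr_ge0.
Qed.

Lemma Im_le_normc z : `|Imc z| <= normc z.
Proof.
case: z => a b /=; rewrite -[leLHS]sqrtr_sqr ler_sqrt.
  by rewrite lerDr sqr_ge0.
by rewrite addr_ge0 ?sqr_ge0.
Qed.

Lemma normcD z w : normc (z + w) <= normc z + normc w.
Proof. exact: (@le_normcD _ z w). Qed.

Lemma normcB z w : normc z - normc w <= normc (z - w).
Proof. by rewrite lerBlDr; apply: le_trans (normcD _ _); rewrite subrK. Qed.

Lemma normc_sum (I : Type) (r : seq I) (P : pred I) (F : I -> R[i]) :
  normc (\sum_(i <- r | P i) F i) <= \sum_(i <- r | P i) normc (F i).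
Proof.
elim/big_rec2: _ => [|i y x _ IH]; first by rewrite ComplexField.Normc.normc0.
by apply: le_trans (normcD _ _) _; rewrite lerD2l.
Qed.

Lemma normc_prod (I : Type) (r : seq I) (P : pred I) (F : I -> R[i]) :
  normc (\prod_(i <- r | P i) F i) = \prod_(i <- r | P i) normc (F i).
Proof.
elim/big_rec2: _ => [|i y x _ IH]; first by rewrite ComplexField.Normc.normc1.
by rewrite ComplexField.Normc.normcM IH.
Qed.

Lemma normcX z n : normc (z ^+ n) = normc z ^+ n.
Proof.
elim: n => [|n IH]; first by rewrite !expr0 ComplexField.Normc.normc1.
by rewrite !exprS ComplexField.Normc.normcM IH.
Qed.

Lemma normc_le_ReIm z : normc z <= `|Rec z| + `|Imc z|.
Proof.
case: z => a b /=; rewrite -[leRHS]ger0_norm ?addr_ge0 ?normr_ge0 // -[leRHS]sqrtr_sqr.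
rewrite ler_sqrt ?sqr_ge0 // sqrrD !real_normK ?num_real //.
by rewrite addrAC lerDl mulrn_wge0 // mulr_ge0.
Qed.

(** Subtracting the right multiple of [2 pi] brings [y / 2] into the interval
    from 0 to [pi], 0 included and [pi] excluded, where [sin] vanishes only at
    0; and [cos y = 1] says that [sin (y / 2) = 0]. *)
Lemma cos_eq1 y : cos y = 1 -> exists n : int, y = 2 * pi * n%:~R.
Proof.
move=> cy.
have pi0 : 0 < 2 * pi :> R by rewrite mulr_gt0 ?pi_gt0.
pose n := Num.floor (y / (2 * pi)).
have /andP[n1 n2] : (n%:~R <= y / (2 * pi) < (n + 1)%:~R).
  by rewrite ge_floor ?floorD1_gt.
exists n.
pose t := y / 2 - n%:~R * pi.
have t0 : 0 <= t.
  by rewrite /t; move: n1; rewrite ler_pdivlMr // => n1; lra.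
have t1 : t < pi.
  by rewrite /t; move: n2; rewrite ltr_pdivrMr // intrD mulrDl mul1r => n2; lra.
have per (m : nat) (a : R) : cos (a + (2 * pi) * m%:R) = cos a.
  elim: m => [|m IH]; first by rewrite mulr0 addr0.
  by rewrite -[m.+1%:R]natr1 mulrDr mulr1 addrA
    (mulr_natl pi 2) cosD2pi -(mulr_natl pi 2) IH.
have c2t : cos (t *+ 2) = 1.
  have -> : t *+ 2 = y - 2 * pi * n%:~R by rewrite /t mulr2n; field.
  rewrite -[RHS]cy; case: (n) => m.
    by rewrite -[LHS](per m) -pmulrn subrK.
  by rewrite NegzE intrN mulrN opprK per.
have st : sin t = 0.
  move: c2t; rewrite cos_mulr2n => h; apply/eqP; rewrite -sqrf_eq0 sin2cos2; apply/eqP; lra.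
have t_eq0 : t = 0.
  apply/eqP; rewrite eq_le t0 andbT leNgt; apply/negP => t0'.
  by have := @sin_gt0_pi _ t; rewrite t0' t1 st ltxx => /(_ isT).
by move: t_eq0; rewrite /t => h; lra.
Qed.

Lemma cexp_eq1 z : cexp z = 1 -> exists n : int, z = 0 +i* (2 * pi * n%:~R).
Proof.
move=> h.
have e1 : expR (Rec z) = 1 by rewrite -normc_cexp h ComplexField.Normc.normc1.
have r0 : Rec z = 0 by apply: expR_inj; rewrite e1 expR0.
have [|n hn] := @cos_eq1 (Imc z).
  by move: (congr1 (@complex.Re _) h); rewrite Re_cexp e1 mul1r.
by exists n; apply: complex_ext; rewrite /= ?r0 ?hn.
Qed.

Lemma cexp_2piZ (n : int) : cexp (0 +i* (2 * pi * n%:~R)) = 1 :> R[i].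
Proof.
suff P (m : nat) : cexp (0 +i* (2 * pi * m%:R)) = 1 :> R[i].
  case: n => m; first exact: P.
  rewrite NegzE intrN mulrN -[X in cexp X]opprK cexpN.
  have -> : - (0 +i* - (2 * pi * m.+1%:~R)) = 0 +i* (2 * pi * m.+1%:R) :> R[i].
    by apply: complex_ext; rewrite /= ?oppr0 ?opprK.
  by rewrite P invr1.
have -> : 0 +i* (2 * pi * m%:R) = (0 +i* (2 * pi)) *+ m :> R[i].
  elim: m => [|m IH]; first by rewrite mulr0.
  rewrite [RHS]mulrS -[in RHS]IH; apply: complex_ext; rewrite !cE /= ?addr0 //.
  by rewrite -[m.+1%:R]natr1; ring.
rewrite cexpMn (_ : cexp _ = 1) ?expr1n //.
by apply: complex_ext; rewrite ?Re_cexp ?Im_cexp /= expR0 mul1r mulr_natl ?cos2pi ?sin2pi.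
Qed.

End ComplexExp.

(** * Finite q-products and the triple product identity *)

Section QBinomial.
Variable A : comNzRingType.
Implicit Types q z : A.

(** The Gaussian binomial coefficient, given by its Pascal rule: a quotient of
    q-factorials would require [q] not to be a root of unity. *)
Fixpoint qbin q (n k : nat) : A :=
  match n, k with
  | _, 0%N => 1
  | 0%N, k'.+1 => 0
  | n'.+1, k'.+1 => qbin q n' k' + q ^+ k'.+1 * qbin q n' k'.+1
  end.

Lemma qbin0 q n : qbin q n 0 = 1.
Proof. by case: n. Qed.

Lemma qbin_small q n k : (n < k)%N -> qbin q n k = 0.
Proof.
elim: n k => [|n IH] [|k] //= nk.
by rewrite !IH ?mulr0 ?addr0 // ltnW.
Qed.

(** Splitting off the factor [m = 0] gives [P_(n+1)(z) = (1 + z) P_n(q z)],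
    and comparing coefficients yields the Pascal rule. *)
Lemma qbinomial_theorem q n z :
  \prod_(m < n) (1 + q ^+ m * z) =
  \sum_(j < n.+1) qbin q n j * q ^+ 'C(j, 2) * z ^+ j.
Proof.
elim: n z => [|n IH] z.
  by rewrite big_ord0 big_ord_recl big_ord0 /= !mul1r !expr0 addr0.
rewrite big_ord_recl expr0 mul1r.
under eq_bigr => i _ do rewrite exprSr -mulrA.
rewrite IH mulrDl mul1r [LHS]addrC mulr_sumr [RHS]big_ord_recl /= expr0 !mulr1.
rewrite [X in _ + X = _]big_ord_recl qbin0 /= expr0 !mulr1 addrCA; congr (_ + _).
under [RHS]eq_bigr => i _ do rewrite /bump /= add1n mulrDl mulrDl.
rewrite big_split /=; congr (_ + _).
  apply: eq_bigr => i _; rewrite binS bin1 exprD exprMn exprS.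
  ring.
rewrite [RHS]big_ord_recr /= qbin_small // mulr0 !mul0r addr0.
apply: eq_bigr => i _; rewrite /bump /= add1n exprMn; ring.
Qed.

End QBinomial.

Section QProducts.
Variable R : realType.
Implicit Types (q z : R[i]).

(** A Weierstrass product inequality: [(1 - s)(1 - t) >= 1 - s - t], summed
    over a geometric series. *)
Lemma qprod_ge_half q z N : normc q < 1 -> normc z <= (1 - normc q) / 2 ->
  1 - (1 - normc q ^+ N) / 2 <= normc (\prod_(m < N) (1 - q ^+ m * z)).
Proof.
move=> q1 zs; have q0 := normc_ge0 q.
elim: N => [|N IH].
  by rewrite big_ord0 expr0 subrr mul0r subr0 ComplexField.Normc.normc1.
rewrite big_ord_recr /= ComplexField.Normc.normcM.
have := normcB 1 (q ^+ N * z).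
rewrite ComplexField.Normc.normcM ComplexField.Normc.normc1 normcX => h.
suff key (a b c u v : R) : 0 <= a -> a <= 1 -> 0 <= b -> 0 <= c -> c < 1 ->
    b <= (1 - c) / 2 -> 1 - a * b <= u -> 1 - (1 - a) / 2 <= v ->
    1 - (1 - c * a) / 2 <= v * u.
  rewrite exprS; apply: (key _ (normc z)) => //.
  - by rewrite exprn_ge0.
  - by rewrite exprn_ile1 // ltW.
  - exact: normc_ge0.
move=> a0 a1 b0 c0 c1 bc hu hv.
have ab : a * b <= a * ((1 - c) / 2) by rewrite ler_wpM2l.
have ac : 0 <= a * c by rewrite mulr_ge0.
have ac1 : a * c <= a by rewrite -[leRHS]mulr1 ler_wpM2l // ltW.
apply: le_trans (_ : (1 - (1 - a) / 2) * (1 - a * b) <= _); last first.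
  by apply: ler_pM => //; nra.
nra.
Qed.

(** The factors tend to 1 geometrically, so only finitely many of them matter:
    the functional equation [P_(N+1)(z) = (1 - z) P_N(q z)] reduces any [z] to
    the range of [qprod_ge_half]. *)
Lemma qprod_lower_bound q z : normc q < 1 -> (forall m, 1 - q ^+ m * z != 0) ->
  exists2 c : R, 0 < c & forall N, c <= normc (\prod_(m < N) (1 - q ^+ m * z)).
Proof.
move=> q1 hz; have q0 := normc_ge0 q.
have [k hk] : exists k : nat, normc z * normc q ^+ k <= (1 - normc q) / 2.
  have e0 : 0 < (1 - normc q) / 2 / (normc z + 1).
    by rewrite divr_gt0 ?divr_gt0 ?subr_gt0 // ltr_wpDl ?normc_ge0.
  have /cvgrPdist_lt/(_ _ e0)[k _ /(_ k (leqnn k))] : 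
      (normc q ^+ n) @[n --> \oo] --> (0 : R).
    by apply: cvg_expr; rewrite ger0_norm.
  rewrite sub0r normrN ger0_norm ?exprn_ge0 // => hk; exists k.
  have z1 : 0 < normc z + 1 by rewrite ltr_wpDl ?normc_ge0.
  move: hk; rewrite ltr_pdivlMr // => /ltW; apply: le_trans.
  by rewrite mulrC ler_wpM2l ?exprn_ge0 // lerDl.
elim: k z hz hk => [|k IH] z hz hk.
  exists (1 / 2) => [|N]; first by rewrite divr_gt0.
  rewrite expr0 mulr1 in hk; apply: le_trans (qprod_ge_half N q1 hk).
  have : 0 <= normc q ^+ N by rewrite exprn_ge0.
  lra.
have [m||c c0 hc] := IH (q * z).
- by have := hz m.+1; rewrite exprSr mulrA.
- by rewrite ComplexField.Normc.normcM mulrAC -exprS mulrC.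
have n0 : 0 < normc (1 - z).
  rewrite lt_def normc_ge0 andbT; apply/eqP => /ComplexField.Normc.eq0_normc.
  by apply/eqP; have := hz 0%N; rewrite expr0 mul1r.
exists (Num.min 1 (normc (1 - z) * c)) => [|[|N]].
- by rewrite lt_min ltr01 mulr_gt0.
- by rewrite big_ord0 ComplexField.Normc.normc1 ge_min lexx.
rewrite big_ord_recl expr0 mul1r ComplexField.Normc.normcM ge_min.
apply/orP; right; rewrite ler_pM2l //.
by under eq_bigr => i _ do rewrite exprSr -mulrA.
Qed.

(** The Pascal rule preserves the bound [prod_(i < k) (1 - r^(i+1))^-1] with
    [r = |q|], and these products are bounded by the inverse of the one in
    [qprod_lower_bound]. *)
Lemma qbin_bounded q : normc q < 1 ->
  exists2 B : R, 0 < B & forall n k, normc (qbin q n k) <= B.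
Proof.
move=> q1; have q0 := normc_ge0 q.
set r := normc q.
have r1 i : r ^+ i.+1 < 1 by rewrite exprn_ilt1.
have e m : 1 - r%:C ^+ m * r%:C = (1 - r ^+ m.+1)%:C :> R[i].
  by rewrite rmorphB rmorph1 rmorphXn -exprSr.
have [|m|c c0 hc] := @qprod_lower_bound r%:C r%:C.
- by rewrite normcR ger0_norm.
- rewrite e.
  by apply/eqP => /(congr1 (@complex.Re _)) /= /eqP; rewrite subr_eq0 gt_eqF.
exists c^-1 => [|n k]; first by rewrite invr_gt0.
apply: le_trans (_ : \prod_(i < k) (1 - r ^+ i.+1)^-1 <= _); last first.
  rewrite prodfV lef_pV2 ?posrE //; last first.
    by apply: prodr_gt0 => i _; rewrite subr_gt0.
  apply: le_trans (hc k) _; rewrite normc_prod.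
  apply: ler_prod => i _; rewrite normc_ge0 /= e.
  by rewrite normcR ger0_norm // subr_ge0 ltW.
elim: n k => [|n IH] [|k].
- by rewrite big_ord0 ComplexField.Normc.normc1.
- rewrite qbin_small // ComplexField.Normc.normc0; apply: prodr_ge0 => i _.
  by rewrite invr_ge0 subr_ge0 ltW.
- by rewrite big_ord0 ComplexField.Normc.normc1.
rewrite [qbin _ _ _]/=; apply: le_trans (normcD _ _) _; rewrite ComplexField.Normc.normcM.
rewrite normcX.
apply: le_trans (_ : \prod_(i < k) (1 - r ^+ i.+1)^-1 + 
  r ^+ k.+1 * \prod_(i < k.+1) (1 - r ^+ i.+1)^-1 <= _).
  by rewrite lerD // ler_wpM2l // exprn_ge0.
rewrite big_ord_recr /=; move: (\prod_(i < k) _) => P.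
rewrite le_eqVlt; apply/orP; left; apply/eqP; field.
by rewrite subr_eq0 gt_eqF.
Qed.

End QProducts.

Section JacobiTriple.
Variable R : realType.
Implicit Types (w t : R[i]).

Lemma cexp_natM w (n : nat) : cexp w ^+ n = cexp (n%:R * w).
Proof. by rewrite -cexpMn mulr_natl. Qed.

Lemma natr_bin2 (A : comNzRingType) (j : nat) :
  2 * ('C(j, 2))%:R = j%:R * (j%:R - 1) :> A.
Proof.
elim: j => [|j IH]; first by rewrite bin0n mulr0 mul0r.
by rewrite binS bin1 natrD mulrDr IH -[j.+1%:R]natr1; ring.
Qed.

(** This is the q-binomial theorem for [2 N] factors at [z = - q^(-N) exp t].
    Inverting the [N] factors that carry a negative power of [q] produces the
    second product; the resulting prefactor [(-1)^N q^(-N(N+1)/2) exp (N t)]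
    turns the exponent [j(j-1)/2] into [k(k-1)/2] with the centred index
    [k = j - N].  Powers of [q] are written as exponentials because [k] may be
    negative. *)
Lemma finite_jacobi_triple_product w t N :
  \sum_(j < N.*2.+1) (-1) ^+ (N + j) * qbin (cexp w) N.*2 j *
     (let k : R[i] := j%:R - N%:R in cexp (k * (k - 1) / 2 * w + k * t)) =
  \prod_(m < N) (1 - cexp w ^+ m * cexp t) *
  \prod_(m < N) (1 - cexp w ^+ m * cexp (w - t)).
Proof.
pose e : R[i] := (- (N%:R * (N%:R + 1) / 2) * w + N%:R * t).
have two0 : (2 : R[i]) != 0 by rewrite pnatr_eq0.
(* The factors with a negative power of q, inverted one by one. *)
have L : cexp e * (-1) ^+ N *
  \prod_(m < N) (1 - cexp w ^+ m * cexp (w - t)) = 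
  \prod_(m < N) (1 - cexp w ^+ m * cexp (t - N%:R * w)).
  rewrite [RHS](reindex_inj rev_ord_inj) /=.
  have -> : cexp e * (-1) ^+ N = \prod_(m < N) - cexp (t - m.+1%:R * w).
    rewrite /e; elim: (N) => [|n IH].
      by rewrite big_ord0 expr0 mulr1 !mul0r oppr0 mul0r add0r cexp0.
    rewrite big_ord_recr /= -IH exprSr.
    rewrite (_ : _ + _ = - (n%:R * (n%:R + 1) / 2) * w + n%:R * t +
      (t - n.+1%:R * w)); last by rewrite -[n.+1%:R]natr1; field.
    by rewrite [in LHS]cexpD; ring.
  rewrite -big_split /=; apply: eq_bigr => i _.
  have -> : cexp w ^+ (N - i.+1) * cexp (t - N%:R * w) = cexp (t - i.+1%:R * w).
    rewrite cexp_natM -cexpD; congr cexp; rewrite natrB //; ring.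
  have h : cexp (t - i.+1%:R * w) * (cexp w ^+ i * cexp (w - t)) = 1.
    rewrite cexp_natM -!cexpD -[RHS]cexp0; congr cexp.
    by rewrite -[i.+1%:R]natr1; ring.
  by rewrite mulrBr mulr1 mulNr h opprK addrC.
have E0 : cexp e * (-1) ^+ N != 0 by rewrite mulf_neq0 ?cexp_neq0 ?signr_eq0.
apply: (mulfI E0).
rewrite [RHS]mulrCA L [RHS]mulrC.
have -> : \prod_(m < N) (1 - cexp w ^+ m * cexp (t - N%:R * w)) *
   \prod_(m < N) (1 - cexp w ^+ m * cexp t) =
   \prod_(m < N.*2) (1 + cexp w ^+ m * - cexp (t - N%:R * w)).
  rewrite -addnn big_split_ord /=; congr (_ * _); apply: eq_bigr => i _.
    by rewrite mulrN.
  rewrite mulrN; congr (1 - _); rewrite !cexp_natM -!cexpD; congr cexp.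
  by rewrite /= natrD; ring.
rewrite qbinomial_theorem mulr_sumr; apply: eq_bigr => j _ /=.
rewrite [(- cexp _) ^+ j]exprNn.
rewrite !cexp_natM exprD.
have -> : cexp e * (-1) ^+ N * ((-1) ^+ N * (-1) ^+ j * qbin (cexp w) N.*2 j *
   cexp ((j%:R - N%:R) * (j%:R - N%:R - 1) / 2 * w + (j%:R - N%:R) * t)) =
   ((-1) ^+ N * (-1) ^+ N) * (-1) ^+ j * qbin (cexp w) N.*2 j * 
  cexp (e + ((j%:R - N%:R) * (j%:R - N%:R - 1) / 2 * w + (j%:R - N%:R) * t)).
  rewrite cexpD; ring.
rewrite -exprMn mulrNN mulr1 expr1n mul1r.
rewrite (_ : e + _ = 'C(j, 2)%:R * w + j%:R * (t - N%:R * w)) ?cexpD; first ring.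
have -> : ('C(j, 2))%:R = j%:R * (j%:R - 1) / 2 :> R[i].
  by rewrite -natr_bin2 mulrC mulKf.
by rewrite /e; field.
Qed.

End JacobiTriple.

(** * Calculus for complex-valued functions of a real variable *)

Section ComplexCalculus.
Variable R : realType.
Implicit Types (f g u : R -> R[i]) (z l : R[i]) (x : R).
Local Notation mu := (@lebesgue_measure R).

(** The two real components are differentiated separately, which gives access
    to the calculus of real functions. *)
Definition is_cderive f x l :=
  is_derive x 1 (fun y => Rec (f y)) (Rec l) /\
  is_derive x 1 (fun y => Imc (f y)) (Imc l).

Lemma is_cderive_eq f x l l' : is_cderive f x l -> l = l' -> is_cderive f x l'.
Proof. by move=> h <-. Qed.

Lemma is_cderive_quadratic (a b c : R[i]) x :
  is_cderive (fun y => a + b * y%:C + c * (y ^+ 2)%:C) x (b + c * (2 * x)%:C).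
Proof.
have D (a0 b0 c0 : R) : is_derive x 1
   (fun y : R => a0 + b0 * y + c0 * y ^+ 2) (b0 + c0 * (2 * x)).
  apply: (@is_derive_eq _ _ _ (cst a0 + (b0 \*: (id : R -> R)) +
    (c0 \*: ((id : R -> R) ^+ 2)))).
  by rewrite add0r /= expr1 /GRing.scale /= !mulr1.
split.
  rewrite (_ : (fun y => _) = fun y : R => Rec a + Rec b * y + Rec c * y ^+ 2).
    rewrite (_ : Rec (b + _) = Rec b + Rec c * (2 * x)) ?cE /= ?mulr0 ?subr0 //.
  by apply/funext => y; rewrite !cE /= !mulr0 !subr0.
rewrite (_ : (fun y => _) = fun y : R => Imc a + Imc b * y + Imc c * y ^+ 2).
  rewrite (_ : Imc (b + _) = Imc b + Imc c * (2 * x)) ?cE /= ?mulr0 ?add0r //.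
by apply/funext => y; rewrite !cE /= !mulr0 !add0r.
Qed.

Lemma is_cderiveM f g x l l' : is_cderive f x l -> is_cderive g x l' ->
  is_cderive (fun y => f y * g y) x (l * g x + f x * l').
Proof.
move=> [f1 f2] [g1 g2]; split.
  rewrite (_ : (fun y => _) = (fun y => Rec (f y)) * (fun y => Rec (g y)) -
    (fun y => Imc (f y)) * (fun y => Imc (g y))).
    by apply: is_derive_eq; rewrite !cE /GRing.scale /=; ring.
  by apply/funext => y; rewrite cE.
rewrite (_ : (fun y => _) = (fun y => Rec (f y)) * (fun y => Imc (g y)) +
    (fun y => Imc (f y)) * (fun y => Rec (g y))).
  by apply: is_derive_eq; rewrite !cE /GRing.scale /=; ring.
by apply/funext => y; rewrite cE.
Qed.

Lemma is_cderive_cexp u x l : is_cderive u x l ->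
  is_cderive (fun y => cexp (u y)) x (l * cexp (u x)).
Proof.
move=> [u1 u2]; split.
  rewrite (_ : (fun y => _) = (expR \o (fun y => Rec (u y))) *
     (cos \o (fun y => Imc (u y)))) //.
  by apply: is_derive_eq; rewrite !cE Re_cexp Im_cexp /GRing.scale /=; ring.
rewrite (_ : (fun y => _) = (expR \o (fun y => Rec (u y))) *
     (sin \o (fun y => Imc (u y)))) //.
by apply: is_derive_eq; rewrite !cE Re_cexp Im_cexp /GRing.scale /=; ring.
Qed.

Lemma cderive0_cst f : (forall x, is_cderive f x 0) -> forall x y, f x = f y.
Proof.
move=> h x y; apply: complex_ext.
  by apply: (@is_derive_0_is_cst _ (fun y => Rec (f y))) => t; have [] := h t.
by apply: (@is_derive_0_is_cst _ (fun y => Imc (f y))) => t; have [] := h t.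
Qed.

Definition ccontinuous f :=
  continuous (fun y => Rec (f y)) /\ continuous (fun y => Imc (f y)).

Lemma cderive_continuous f f' : (forall x, is_cderive f x (f' x)) -> ccontinuous f.
Proof.
move=> h; split => x; apply: differentiable_continuous; apply/derivable1_diffP.
  by have [[]] := h x.
by have [_ []] := h x.
Qed.

Definition cmeasurable f :=
  measurable_fun setT (fun y => Rec (f y)) /\
  measurable_fun setT (fun y => Imc (f y)).

Lemma ccontinuous_measurable f : ccontinuous f -> cmeasurable f.
Proof. by move=> [? ?]; split; apply: continuous_measurable_fun. Qed.

Definition cintegrable f :=
  mu.-integrable setT (EFin \o (fun y => Rec (f y))) /\
  mu.-integrable setT (EFin \o (fun y => Imc (f y))).

Definition cint f : R[i] :=
  (\int[mu]_x Rec (f x)) +i* (\int[mu]_x Imc (f x)).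

Lemma cintegrable_dominated f (g : R -> R) : cmeasurable f ->
  mu.-integrable setT (EFin \o g) -> (forall x, normc (f x) <= g x) ->
  cintegrable f.
Proof.
move=> [m1 m2] ig fg; split; apply: (le_integrable _ _ _ ig) => //.
- exact/measurable_EFinP.
- move=> x _ /=; rewrite lee_fin; apply: le_trans (Re_le_normc _) _.
  by apply: le_trans (fg x) _; rewrite ler_norm.
- exact/measurable_EFinP.
- move=> x _ /=; rewrite lee_fin; apply: le_trans (Im_le_normc _) _.
  by apply: le_trans (fg x) _; rewrite ler_norm.
Qed.

Lemma integrableEZ (r : R) (h : R -> R) : mu.-integrable setT (EFin \o h) ->
  mu.-integrable setT (EFin \o (fun x => r * h x)).
Proof. by move=> ih; apply: (@integrableZl _ _ _ mu setT measurableT r _ ih). Qed.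

Lemma integrableED (h k : R -> R) : mu.-integrable setT (EFin \o h) ->
  mu.-integrable setT (EFin \o k) ->
  mu.-integrable setT (EFin \o (fun x => h x + k x)).
Proof. by move=> ih ik; apply: (@integrableD _ _ _ mu setT measurableT _ _ ih ik). Qed.

Lemma integrableEB (h k : R -> R) : mu.-integrable setT (EFin \o h) ->
  mu.-integrable setT (EFin \o k) ->
  mu.-integrable setT (EFin \o (fun x => h x - k x)).
Proof. by move=> ih ik; apply: (@integrableB _ _ _ mu setT measurableT _ _ ih ik). Qed.

Lemma cintegrableZ z f : cintegrable f -> cintegrable (fun x => z * f x).
Proof.
move=> [f1 f2]; split.
  rewrite (_ : (fun y => _) = fun x => Rec z * Rec (f x) - Imc z * Imc (f x)).
    by apply: integrableEB; apply: integrableEZ.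
  by apply/funext => y; rewrite cE.
rewrite (_ : (fun y => _) = fun x => Rec z * Imc (f x) + Imc z * Rec (f x)).
  by apply: integrableED; apply: integrableEZ.
by apply/funext => y; rewrite cE.
Qed.

Lemma cintegrableD f g : cintegrable f -> cintegrable g ->
  cintegrable (fun x => f x + g x).
Proof.
move=> [f1 f2] [g1 g2]; split.
  rewrite (_ : (fun y => _) = fun x => Rec (f x) + Rec (g x)).
    exact: integrableED.
  by apply/funext => y; rewrite cE.
rewrite (_ : (fun y => _) = fun x => Imc (f x) + Imc (g x)).
  exact: integrableED.
by apply/funext => y; rewrite cE.
Qed.

Lemma cintZ z f : cintegrable f -> cint (fun x => z * f x) = z * cint f.
Proof.
move=> [f1 f2]; apply: complex_ext; rewrite /cint cE /=.
  rewrite -!RintegralZl // -RintegralB //; try exact: integrableEZ.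
  by apply: eq_Rintegral => x _; rewrite cE.
rewrite -!RintegralZl // -RintegralD //; try exact: integrableEZ.
by apply: eq_Rintegral => x _; rewrite cE.
Qed.

Lemma cintD f g : cintegrable f -> cintegrable g ->
  cint (fun x => f x + g x) = cint f + cint g.
Proof.
move=> [f1 f2] [g1 g2]; apply: complex_ext; rewrite /cint cE /= -RintegralD //.
  by apply: eq_Rintegral => x _; rewrite cE.
by apply: eq_Rintegral => x _; rewrite cE.
Qed.

Lemma eq_cint f g : f =1 g -> cint f = cint g.
Proof. by move=> /funext ->. Qed.

(** Domination is asked for on a unit interval around the point only, since
    the Gaussian families to be differentiated are not dominated uniformly in
    the parameter. *)
Lemma is_cderive_under_cint (f f' : R -> R -> R[i]) (a : R) (G : R -> R) :
  (forall t x, is_cderive (f ^~ x) t (f' t x)) ->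
  (forall t, cintegrable (f t)) ->
  mu.-integrable setT (EFin \o G) ->
  (forall t x, `]a - 1, a + 1[%classic t -> normc (f' t x) <= G x) ->
  is_cderive (fun t => cint (f t)) a (cint (f' a)).
Proof.
move=> df intf iG fG.
have Ia : `]a - 1, a + 1[%classic a.
  by rewrite /= in_itv /= ltrBlDr !ltrDl ltr01.
have G0 x : 0 <= G x by apply: le_trans (normc_ge0 _) (fG a x Ia).
(* The real statement, to be applied to both components. *)
have aux (h h' : R -> R -> R) :
    (forall (t x : R), is_derive t (1 : R) (h ^~ x) (h' t x)) ->
    (forall t, mu.-integrable setT (EFin \o h t)) ->
    (forall t x, `]a - 1, a + 1[%classic t -> `|h' t x| <= G x) ->
    is_derive a 1 (fun t => \int[mu]_x h t x) (\int[mu]_x h' a x).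
  move=> dh ih hG.
  have E t x : (partial1of2 h) t x = h' t x.
    by rewrite partial1of2E; have [_ ->] := dh t x.
  have P1 t x : `]a - 1, a + 1[%classic t -> setT x -> derivable (h ^~ x) t 1.
    by move=> _ _; have [] := dh t x.
  have P2 t x : `]a - 1, a + 1[%classic t -> setT x -> `|partial1of2 h t x| <= G x.
    by move=> It _; rewrite E; apply: hG.
  split.
    exact: (derivable_under_integral measurableT Ia (fun t _ => ih t) P1 G0 iG P2).
  rewrite -derive1E.
  rewrite (differentiation_under_integral measurableT Ia (fun t _ => ih t) P1 G0 iG P2).
  by apply: eq_Rintegral => x _; rewrite E.
split => /=.
  apply: (aux (fun t x => Rec (f t x)) (fun t x => Rec (f' t x))).
  - by move=> t x; have [] := df t x.
  - by move=> t; have [] := intf t.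
  - by move=> t x It; apply: le_trans (Re_le_normc _) (fG t x It).
apply: (aux (fun t x => Imc (f t x)) (fun t x => Imc (f' t x))).
- by move=> t x; have [] := df t x.
- by move=> t; have [] := intf t.
- by move=> t x It; apply: le_trans (Im_le_normc _) (fG t x It).
Qed.

(** By the fundamental theorem of calculus the integral from [- n] to [n] is
    [h n - h (- n)]; dominated convergence carries this to the whole line. *)
Lemma Rintegral_derive_eq0 (h h' : R -> R) :
  (forall x, is_derive x 1 h (h' x)) -> continuous h' ->
  mu.-integrable setT (EFin \o h') ->
  h (n%:R) @[n --> \oo] --> 0 -> h (- n%:R) @[n --> \oo] --> 0 ->
  \int[mu]_x h' x = 0.
Proof.
move=> dh ch ih h1 h2.
have ch0 : continuous h.
  move=> x; apply: differentiable_continuous; apply/derivable1_diffP.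
  by have [] := dh x.
pose A (n : nat) : set R := `[- n.+1%:R, n.+1%:R]%classic.
have E n : (\int[mu]_x ((h' \_ (A n)) x)%:E = (h (n.+1%:R) - h (- n.+1%:R))%:E)%E.
  have := @continuous_FTC2 R h' h (- n.+1%:R) (n.+1%:R).
  rewrite integral_mkcond EFinB => <- //.
  - by apply: eq_integral => x _; rewrite restrict_EFin.
  - by rewrite gtrN // ltr0n.
  - by apply: continuous_subspaceT.
  - split.
    + by move=> x _; have [] := dh x.
    + by apply: cvg_at_right_filter; apply: ch0.
    + by apply: cvg_at_left_filter; apply: ch0.
  - by move=> x _; rewrite derive1E; have [_ ->] := dh x.
have mA n : measurable (A n) by apply: measurable_itv.
have mh' : measurable_fun setT h' by apply: continuous_measurable_fun.
have C1 : (\int[mu]_x ((h' \_ (A n)) x)%:E)%E @[n --> \oo] --> (\int[mu]_x (h' x)%:E)%E.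
  apply: (@dominated_cvg _ _ _ mu setT measurableT _ _ (fun x => `|h' x|%:E)) => //.
  - move=> n; apply/measurable_EFinP; apply/(measurable_restrict _ (mA n)) => //.
    by apply: measurable_funS mh'.
  - move=> x _; apply: cvg_near_cst.
    have [N hN] : exists N : nat, `|x| <= N%:R.
      exists (Num.truncn `|x|).+1; apply: ltW.
      by have /andP[] := truncn_itv (normr_ge0 x).
    exists N => // n /= Nn; rewrite /patch mem_set // /A /= in_itv /=.
    rewrite -ler_norml; apply: le_trans hN _; rewrite ler_nat.
    exact: leq_trans Nn _.
  - exact: (@integrable_abse _ _ _ mu setT _ ih).
  - move=> n x _; rewrite lee_fin /patch; case: ifP => // _.
    by rewrite normr0.
have C2 : (\int[mu]_x ((h' \_ (A n)) x)%:E)%E @[n --> \oo] --> (0%:E)%E.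
  rewrite (_ : (fun n => _) = EFin \o (fun n => h (n.+1%:R) - h (- n.+1%:R))); last first.
    by apply/funext => n; rewrite E.
  apply: cvg_EFin; first exact: nearW.
  rewrite /comp /= -[X in _ --> X]subr0; apply: cvgB.
    by rewrite (cvg_shiftS (fun n : nat => h n%:R)).
  by rewrite (cvg_shiftS (fun n : nat => h (- n%:R))).
rewrite /Rintegral; have -> : (\int[mu]_x (h' x)%:E = 0)%E; last by [].
by rewrite -(cvg_lim _ C1) // (cvg_lim _ C2).
Qed.

(** The source of all integrations by parts for the Gaussian moments. *)
Lemma cint_derive_eq0 (h h' : R -> R[i]) :
  (forall x, is_cderive h x (h' x)) -> ccontinuous h' -> cintegrable h' ->
  normc (h n%:R) @[n --> \oo] --> 0 -> normc (h (- n%:R)) @[n --> \oo] --> 0 ->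
  cint h' = 0.
Proof.
move=> dh [c1 c2] [i1 i2] l1 l2.
have sq (u : nat -> R) (v : nat -> R) : (forall n, `|u n| <= v n) ->
    v n @[n --> \oo] --> 0 -> u n @[n --> \oo] --> 0.
  move=> uv v0; apply: norm_cvg0; apply: (@squeeze_cvgr _ _ _ _ (cst 0) v) => //.
    by apply: nearW => n; rewrite /= normr_ge0 uv.
  exact: cvg_cst.
apply: complex_ext => /=.
  apply: (@Rintegral_derive_eq0 (fun y => Rec (h y))) => //.
  - by move=> x; have [] := dh x.
  - by apply: sq l1 => n; apply: Re_le_normc.
  - by apply: sq l2 => n; apply: Re_le_normc.
apply: (@Rintegral_derive_eq0 (fun y => Imc (h y))) => //.
- by move=> x; have [] := dh x.
- by apply: sq l1 => n; apply: Im_le_normc.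
- by apply: sq l2 => n; apply: Im_le_normc.
Qed.

End ComplexCalculus.

(** * Gaussian integrals with complex parameters *)

Section GaussianIntegrals.
Variable R : realType.
Implicit Types (p s z : R[i]) (x c : R).
Local Notation mu := (@lebesgue_measure R).

(** Reduces integrability and positivity of centred Gaussians to those of
    normal densities. *)
Lemma expR_sqr_pdf c : 0 < c -> exists (sigma k : R),
  0 < k /\ forall x, expR (- c * x ^+ 2) = k * normal_pdf 0 sigma x.
Proof.
move=> c0; pose sigma := Num.sqrt (2 * c)^-1.
have s0 : sigma != 0 by rewrite gt_eqF // sqrtr_gt0 invr_gt0 mulr_gt0.
exists sigma, (normal_peak sigma)^-1; split; first by rewrite invr_gt0 normal_peak_gt0.
move=> x; rewrite normal_pdfE //= mulKf ?gt_eqF ?normal_peak_gt0 //.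
rewrite /normal_fun subr0 sqr_sqrtr ?invr_ge0; last by rewrite mulr_ge0 // ltW.
congr expR; rewrite mulrC mulNr mulrN -[(_^-1 *+ 2)]mulr_natr; congr (- (_ * _)).
by field; rewrite gt_eqF.
Qed.

Lemma integrable_expR_sqr c : 0 < c ->
  mu.-integrable setT (EFin \o (fun x => expR (- c * x ^+ 2))).
Proof.
move=> /expR_sqr_pdf[sigma [k [k0 h]]].
rewrite (_ : (fun x => _) = fun x => k * normal_pdf 0 sigma x); last exact/funext.
by apply: integrableEZ; apply: integrable_normal_pdf.
Qed.

Lemma Rintegral_expR_sqr_gt0 c : 0 < c -> 0 < \int[mu]_x expR (- c * x ^+ 2).
Proof.
move=> /expR_sqr_pdf[sigma [k [k0 h]]].
rewrite (_ : (fun x => _) = fun x => k * normal_pdf 0 sigma x); last exact/funext.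
rewrite RintegralZl //; last exact: integrable_normal_pdf.
by rewrite /Rintegral integral_normal_pdf /= mulr1.
Qed.

Definition cgauss p s x : R[i] := cexp (s * x%:C - p * (x ^+ 2)%:C).

Lemma normc_cgauss p s x :
  normc (cgauss p s x) = expR (Rec s * x - Rec p * x ^+ 2).
Proof. by rewrite normc_cexp !cE /= !mulr0 !subr0. Qed.

(** Quadratic factors are what differentiation of a Gaussian in its parameters
    brings down. *)
Definition cquad (a b c : R[i]) x : R[i] := a + b * x%:C + c * (x ^+ 2)%:C.

Lemma cquad_bound (a b c : R[i]) x :
  normc (cquad a b c x) <= (normc a + normc b + normc c) * (1 + x ^+ 2).
Proof.
have x2 := sqr_ge0 x.
apply: le_trans (normcD _ _) _; rewrite ComplexField.Normc.normcM normcR (ger0_norm x2).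
apply: le_trans (_ : normc a + normc b * `|x| + normc c * x ^+ 2 <= _).
  rewrite lerD2r; apply: le_trans (normcD _ _) _.
  by rewrite ComplexField.Normc.normcM normcR.
have xl : `|x| <= 1 + x ^+ 2.
  by have := sqr_ge0 (`|x| - 1); rewrite sqrrB real_normK ?num_real // mulr1; lra.
rewrite !mulrDl; apply: lerD; first apply: lerD.
- by rewrite ler_peMr ?normc_ge0 // lerDl.
- by rewrite ler_wpM2l ?normc_ge0.
- by rewrite ler_wpM2l ?normc_ge0 // lerDr.
Qed.

(** Half of the decay of the Gaussian absorbs the linear exponent, a further
    quarter absorbs the polynomial factor.  The constant depends on [p] and
    [s] only through [c] and [S], so that it serves as a domination along a
    path of parameters. *)
Lemma cquad_gauss_bound (a b d : R[i]) c S : 0 < c -> exists2 K : R, 0 <= K &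
  forall p s x, Rec p = c -> `|Rec s| <= S ->
    normc (cquad a b d x * cgauss p s x) <= K * expR (- (c / 4) * x ^+ 2).
Proof.
move=> c0; pose L := normc a + normc b + normc d.
have L0 : 0 <= L by rewrite !addr_ge0 ?normc_ge0.
exists (L * ((1 + 4 / c) * expR (S ^+ 2 / (2 * c)))) => [|p s x pc sS].
  rewrite mulr_ge0 // mulr_ge0 ?expR_ge0 // addr_ge0 // divr_ge0 // ltW //.
rewrite ComplexField.Normc.normcM normc_cgauss pc.
apply: le_trans (ler_wpM2r (expR_ge0 _) (cquad_bound _ _ _ _)) _.
rewrite -/L -mulrA -[leRHS]mulrA ler_wpM2l //.
have x2 := sqr_ge0 x.
have h1 : 1 + x ^+ 2 <= (1 + 4 / c) * expR (c / 4 * x ^+ 2).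
  have y0 : 0 <= c / 4 * x ^+ 2 by rewrite mulr_ge0 // divr_ge0 // ltW.
  have hx : x ^+ 2 = 4 / c * (c / 4 * x ^+ 2) by field; rewrite gt_eqF.
  have q0 : 0 < 4 / c by rewrite divr_gt0.
  rewrite [in leLHS]hx.
  move: (c / 4 * x ^+ 2) (4 / c) q0 y0 => y k k0 y0.
  by have := expR_ge1Dx y; move: (expR y) => e e1; nra.
have h2 : Rec s * x - c * x ^+ 2 <= S ^+ 2 / (2 * c) - c / 2 * x ^+ 2.
  have t2 : Rec s ^+ 2 <= S ^+ 2.
    by rewrite -[leLHS]real_normK ?num_real // ler_sqr ?nnegrE // (le_trans _ sS).
  have : 0 <= (Rec s - c * x) ^+ 2 / (2 * c).
    by rewrite divr_ge0 ?sqr_ge0 // mulr_ge0 // ltW.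
  have -> : (Rec s - c * x) ^+ 2 / (2 * c) =
     Rec s ^+ 2 / (2 * c) - Rec s * x + c / 2 * x ^+ 2 by field; rewrite gt_eqF.
  have : Rec s ^+ 2 / (2 * c) <= S ^+ 2 / (2 * c).
    by rewrite ler_wpM2r // invr_ge0 mulr_ge0 // ltW.
  move: (_ / (2 * c)) (S ^+ 2 / _) => u v; lra.
apply: le_trans (ler_pM _ (expR_ge0 _) h1 (_ : _ <= expR _)) _.
- by rewrite addr_ge0.
- by rewrite ler_expR; apply: h2.
rewrite -!mulrA ler_wpM2l ?addr_ge0 ?divr_ge0 // ?(ltW c0) // -!expRD ler_expR; lra.
Qed.

Lemma cgauss_cderive p s x :
  is_cderive (cgauss p s) x ((s - 2 * p * x%:C) * cgauss p s x).
Proof.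
apply: is_cderive_cexp.
have := @is_cderive_quadratic R 0 s (- p) x.
rewrite (_ : (fun y => _) = fun y : R => s * y%:C - p * (y ^+ 2)%:C); last first.
  by apply/funext => y; rewrite add0r mulNr.
move/is_cderive_eq; apply.
by rewrite rmorphM /= mulNr; congr (_ - _); rewrite rmorph_nat; ring.
Qed.

Lemma cquad_cderive (a b c : R[i]) x :
  is_cderive (cquad a b c) x (cquad b (2 * c) 0 x).
Proof.
have := @is_cderive_quadratic R a b c x; move/is_cderive_eq; apply.
by rewrite /cquad rmorphM /= rmorph_nat; ring.
Qed.

Lemma cquad_gauss_ccontinuous (a b c p s : R[i]) :
  ccontinuous (fun x => cquad a b c x * cgauss p s x).
Proof.
apply: cderive_continuous => x.
exact: is_cderiveM (cquad_cderive _ _ _ _) (cgauss_cderive _ _ _).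
Qed.

Lemma cquad_gauss_cintegrable (a b c p s : R[i]) : 0 < Rec p ->
  cintegrable (fun x => cquad a b c x * cgauss p s x).
Proof.
move=> p0; have [K K0 hK] := cquad_gauss_bound a b c `|Rec s| p0.
apply: (cintegrable_dominated (g := fun x => K * expR (- (Rec p / 4) * x ^+ 2))).
- exact/ccontinuous_measurable/cquad_gauss_ccontinuous.
- by apply: integrableEZ; apply: integrable_expR_sqr; rewrite divr_gt0.
- by move=> x; apply: hK.
Qed.

Lemma expR_sqr_cvg0 c : 0 < c -> expR (- c * n%:R ^+ 2) @[n --> \oo] --> (0 : R).
Proof.
move=> c0.
apply: (@squeeze_cvgr _ _ _ _ (cst 0) (fun n : nat => expR (- c) ^+ n)).
- apply: nearW => n; rewrite /= expR_ge0 /= -expRM_natl ler_expR mulNr mulrN lerN2.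
  rewrite mulrC ler_wpM2l ?(ltW c0) // -natrX ler_nat.
  by case: n => // n; rewrite -mulnn leq_pmulr.
- exact: cvg_cst.
- by apply: cvg_expr; rewrite ger0_norm ?expR_ge0 // expR_lt1 oppr_lt0.
Qed.

Definition gmoment (a b c p s : R[i]) := cint (fun x => cquad a b c x * cgauss p s x).

Lemma gmoment_lin (a b c p s : R[i]) : 0 < Rec p ->
  gmoment a b c p s =
  a * gmoment 1 0 0 p s + b * gmoment 0 1 0 p s + c * gmoment 0 0 1 p s.
Proof.
move=> p0; have I (u v w : R[i]) := cquad_gauss_cintegrable u v w s p0.
rewrite /gmoment -!cintZ // -!cintD //; try by repeat apply: cintegrableD; apply: cintegrableZ.
by apply: eq_cint => x; rewrite /cquad; ring.
Qed.

(** The integral of the derivative of [(a + b x) exp (s x - p x^2)] is 0. *)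
Lemma gauss_by_parts (a b p s : R[i]) : 0 < Rec p ->
  gmoment (b + a * s) (b * s - 2 * p * a) (- 2 * p * b) p s = 0.
Proof.
move=> p0.
have [K K0 hK] := cquad_gauss_bound a b 0 `|Rec s| p0.
have c40 : 0 < Rec p / 4 by rewrite divr_gt0.
have lim : K * expR (- (Rec p / 4) * n%:R ^+ 2) @[n --> \oo] --> (0 : R).
  by rewrite -[X in _ --> X](mulr0 K); apply: cvgMr; apply: expR_sqr_cvg0.
apply: (@cint_derive_eq0 _ (fun x => cquad a b 0 x * cgauss p s x)).
- move=> x; apply: is_cderive_eq.
    exact: is_cderiveM (cquad_cderive _ _ _ _) (cgauss_cderive _ _ _).
  by rewrite /cquad rmorphXn /=; ring.
- exact: cquad_gauss_ccontinuous.
- exact: cquad_gauss_cintegrable.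
- apply: (@squeeze_cvgr _ _ _ _ (cst 0) _ _ _ _ _ lim); last exact: cvg_cst.
  by apply: nearW => n; rewrite /= normc_ge0 hK.
- apply: (@squeeze_cvgr _ _ _ _ (cst 0) _ _ _ _ _ lim); last exact: cvg_cst.
  by apply: nearW => n; rewrite /= normc_ge0 -[n%:R ^+ 2]sqrrN hK.
Qed.

(** Along the path [(p + i t r, t s)] the real part of [p] is constant, so
    that the integrands stay dominated locally in [t]. *)
Lemma gmoment_path (p s : R[i]) (r t : R) : 0 < Rec p ->
  is_cderive (fun t => gmoment 1 0 0 (p + 0 +i* (t * r)) (t%:C * s)) t
    (gmoment 0 s (- (0 +i* r)) (p + 0 +i* (t * r)) (t%:C * s)).
Proof.
move=> p0.
have [K K0 hK] := cquad_gauss_bound 0 s (- (0 +i* r)) ((`|t| + 1) * `|Rec s|) p0.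
apply: (@is_cderive_under_cint R
  (fun t x => cquad 1 0 0 x * cgauss (p + 0 +i* (t * r)) (t%:C * s) x)
  (fun t x => cquad 0 s (- (0 +i* r)) x * cgauss (p + 0 +i* (t * r)) (t%:C * s) x)
  _ (fun x => K * expR (- (Rec p / 4) * x ^+ 2))).
- move=> u x.
  rewrite (_ : (fun _ => _) = (fun y : R => cexp ((- p * (x ^+ 2)%:C) +
    (s * x%:C - (0 +i* r) * (x ^+ 2)%:C) * y%:C + 0 * (y ^+ 2)%:C))).
    apply: is_cderive_eq.
      by apply: is_cderive_cexp; apply: is_cderive_quadratic.
    rewrite /cgauss /cquad (_ : 0 +i* (u * r) = u%:C * (0 +i* r)).
      by congr (_ * cexp _); ring.
    by apply: complex_ext; rewrite !cE /=; ring.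
  apply/funext => y; rewrite /cquad /cgauss !mul0r !addr0 mul1r.
  rewrite (_ : 0 +i* (y * r) = y%:C * (0 +i* r)).
    by congr cexp; ring.
  by apply: complex_ext; rewrite !cE /=; ring.
- by move=> u; apply: cquad_gauss_cintegrable; rewrite cE /= addr0.
- by apply: integrableEZ; apply: integrable_expR_sqr; rewrite divr_gt0.
move=> u x; rewrite /= in_itv /= => /andP[u1 u2]; apply: hK; first by rewrite cE /= addr0.
rewrite cE /= mul0r subr0 normrM ler_wpM2r // -lerBlDl.
apply: le_trans (lerB_dist _ _) _.
by rewrite ler_norml; apply/andP; split; lra.
Qed.

(** A replacement for shifting the contour: differentiating
    [exp (- t^2 s^2 / 4 p)] times the integral with [s] replaced by [t s], and
    integrating by parts, gives 0. *)
Lemma gmoment_complete_square (p s : R[i]) : 0 < Rec p ->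
  gmoment 1 0 0 p s = cexp (s ^+ 2 / (4 * p)) * gmoment 1 0 0 p 0.
Proof.
move=> p0.
have pn0 : p != 0 by apply/eqP => h; rewrite h ltxx in p0.
(* The zero coefficients match the general quadratic of is_cderive_quadratic. *)
pose f (t : R) := cexp (0 + 0 * t%:C + (- (s ^+ 2 / (4 * p))) * (t ^+ 2)%:C) *
   gmoment 1 0 0 (p + 0 +i* (t * 0)) (t%:C * s).
have E (t : R) : p + 0 +i* (t * 0) = p by rewrite mulr0 addr0.
have : f 1 = f 0.
  apply: cderive0_cst => t; rewrite /f; apply: is_cderive_eq.
    apply: is_cderiveM; last exact: gmoment_path.
    by apply: is_cderive_cexp; apply: is_cderive_quadratic.
  have Z : - (0 +i* 0) = 0 :> R[i] by apply: complex_ext; rewrite /= oppr0.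
  rewrite !E [gmoment 0 s _ _ _]gmoment_lin // Z !mul0r !add0r addr0.
  have := @gauss_by_parts 1 0 p (t%:C * s) p0.
  rewrite gmoment_lin // => h.
  have {h} : 2 * p * gmoment 0 1 0 p (t%:C * s) = t%:C * s * gmoment 1 0 0 p (t%:C * s).
    apply/eqP; rewrite -subr_eq0 -[X in _ == X]oppr0 -[X in _ == - X]h; apply/eqP; ring.
  move: (gmoment 0 1 0 _ _) (gmoment 1 0 0 _ _) (cexp _) => m1 m0 e h.
  have -> : m1 = t%:C * s * m0 / (2 * p).
    by rewrite -h mulrC mulKf // mulf_neq0 // pnatr_eq0.
  rewrite rmorphM /= rmorph_nat; field; exact: pn0.
rewrite /f !E mul0r expr1n expr0n /= !mulr0 !mulr1 !mul0r !addr0 !add0r cexp0 !mul1r => <-.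
by rewrite mulrA -cexpD subrr cexp0 mul1r.
Qed.

(** Let [K] be the integral of [exp (- p x^2)].  Along the vertical segment
    from [Re p] to [p] the derivative of [K^2 p] is 0 by an integration by
    parts, and at [Re p] its value is positive.  Squaring avoids a choice of
    the square root of [p]. *)
Lemma gmoment_neq0 (p : R[i]) : 0 < Rec p -> gmoment 1 0 0 p 0 != 0.
Proof.
move=> p0; pose p' := (Rec p)%:C; pose r := Imc p.
have P (t : R) : 0 < Rec (p' + 0 +i* (t * r)) by rewrite cE /= addr0.
pose f (t : R) := gmoment 1 0 0 (p' + 0 +i* (t * r)) (t%:C * 0) *
   gmoment 1 0 0 (p' + 0 +i* (t * r)) (t%:C * 0) *
   (p' + (0 +i* r) * t%:C + 0 * (t ^+ 2)%:C).
have : f 1 = f 0.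
  apply: cderive0_cst => t; rewrite /f; apply: is_cderive_eq.
    apply: is_cderiveM; last exact: is_cderive_quadratic.
    by apply: is_cderiveM; apply: gmoment_path.
  rewrite [gmoment 0 0 _ _ _]gmoment_lin // mulr0.
  have := @gauss_by_parts 0 1 (p' + 0 +i* (t * r)) 0 (P t).
  rewrite gmoment_lin //.
  have -> : 0 +i* (t * r) = (0 +i* r) * t%:C.
    by apply: complex_ext; rewrite !cE /=; ring.
  move: (gmoment 0 0 1 _ _) (gmoment 0 1 0 _ _) (gmoment 1 0 0 _ _) => m2 m1 m0 h.
  have -> : m0 = 2 * (p' + (0 +i* r) * t%:C) * m2.
    apply/eqP; rewrite -subr_eq0 -[X in _ == X]h; apply/eqP; ring.
  ring.
have E1 : p' + 0 +i* (1 * r) = p by apply: complex_ext; rewrite !cE /=; ring.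
have E0 : p' + 0 +i* (0 * r) = p' by rewrite mul0r addr0.
rewrite /f E1 E0 !mulr0 !mul0r !addr0 => h; apply/eqP => m0.
move: h; rewrite m0 !mul0r => /esym/eqP; rewrite !mulf_eq0 orbb.
have -> : (gmoment 1 0 0 p' 0 == 0) = false.
  apply/negP => /eqP /(congr1 (@complex.Re _)) /= /eqP; rewrite gt_eqF //.
  rewrite (_ : (fun x => _) = (fun x => expR (- Rec p * x ^+ 2))).
    exact: Rintegral_expR_sqr_gt0.
  apply/funext => x; rewrite !(mul0r, mulr0, addr0, add0r, subr0, mul1r, cos0, mulr1).
  by rewrite !oppr0 add0r cos0 mulr1 mulNr.
move=> /= /eqP /(congr1 (@complex.Re _)) /= /eqP; rewrite gt_eqF //.
Qed.

Lemma gaussian_integral (p s : R[i]) : 0 < Rec p ->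
  cint (cgauss p s) = cint (cgauss p 0) * cexp (s ^+ 2 / (4 * p)).
Proof.
move=> p0; have := gmoment_complete_square s p0.
have E u : gmoment 1 0 0 p u = cint (cgauss p u).
  by apply: eq_cint => x; rewrite /cquad !mul0r !addr0 mul1r.
by rewrite !E mulrC.
Qed.

End GaussianIntegrals.

(** * Pairing and the Cauchy-Schwarz inequality *)

Section Pairing.
Variable R : realType.
Implicit Types (f g u v : R -> R[i]).
Local Notation mu := (@lebesgue_measure R).

Lemma cmeasurableD f g : cmeasurable f -> cmeasurable g ->
  cmeasurable (fun x => f x + g x).
Proof.
move=> [f1 f2] [g1 g2]; split.
  rewrite (_ : (fun y => _) = (fun x => Rec (f x)) \+ (fun x => Rec (g x))).
    exact: measurable_funD.
  by apply/funext => y; rewrite cE.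
rewrite (_ : (fun y => _) = (fun x => Imc (f x)) \+ (fun x => Imc (g x))).
  exact: measurable_funD.
by apply/funext => y; rewrite cE.
Qed.

Lemma cmeasurableM f g : cmeasurable f -> cmeasurable g ->
  cmeasurable (fun x => f x * g x).
Proof.
move=> [f1 f2] [g1 g2]; split.
  rewrite (_ : (fun y => _) = ((fun x => Rec (f x)) \* (fun x => Rec (g x))) \-
     ((fun x => Imc (f x)) \* (fun x => Imc (g x)))).
    by apply: measurable_funB; apply: measurable_funM.
  by apply/funext => y; rewrite cE.
rewrite (_ : (fun y => _) = ((fun x => Rec (f x)) \* (fun x => Imc (g x))) \+
     ((fun x => Imc (f x)) \* (fun x => Rec (g x)))).
  by apply: measurable_funD; apply: measurable_funM.
by apply/funext => y; rewrite cE.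
Qed.

Lemma cmeasurable_cst (z : R[i]) : cmeasurable (fun _ => z).
Proof. by split; apply: measurable_cst. Qed.

Lemma cmeasurable_sum n (F : 'I_n -> R -> R[i]) :
  (forall i, cmeasurable (F i)) -> cmeasurable (fun x => \sum_(i < n) F i x).
Proof.
elim: n F => [|n IH] F hF.
  rewrite (_ : (fun x => _) = fun _ => 0); first exact: cmeasurable_cst.
  by apply/funext => x; rewrite big_ord0.
rewrite (_ : (fun x => _) = fun x => F ord0 x + \sum_(i < n) F (lift ord0 i) x).
  by apply: cmeasurableD => //; apply: IH => i.
by apply/funext => x; rewrite big_ord_recl.
Qed.

Lemma cint0 : cint (fun _ : R => 0) = 0.
Proof.
apply: complex_ext; rewrite /= /Rintegral integral0_eq //.
Qed.

Lemma cint_sum n (F : 'I_n -> R -> R[i]) : (forall i, cintegrable (F i)) ->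
  cintegrable (fun x => \sum_(i < n) F i x) /\
  cint (fun x => \sum_(i < n) F i x) = \sum_(i < n) cint (F i).
Proof.
elim: n F => [|n IH] F hF.
  rewrite (_ : (fun x => _) = fun _ => 0); last by apply/funext => x; rewrite big_ord0.
  rewrite big_ord0 cint0; split => //.
  by split; apply: integrable0.
rewrite (_ : (fun x => _) = fun x => F ord0 x + \sum_(i < n) F (lift ord0 i) x); last first.
  by apply/funext => x; rewrite big_ord_recl.
have [i1 i2] := IH (fun i => F (lift ord0 i)) (fun i => hF _).
split; first exact: cintegrableD.
by rewrite cintD // i2 big_ord_recl.
Qed.

Lemma measurable_normc f : cmeasurable f -> measurable_fun setT (fun x => normc (f x)).
Proof.
move=> [f1 f2].
rewrite (_ : (fun x => _) = Num.sqrt \o (fun x => Rec (f x) ^+ 2 + Imc (f x) ^+ 2)).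
  apply: measurableT_comp; last by apply: measurable_funD; apply: measurable_funX.
  by apply: continuous_measurable_fun; apply: sqrt_continuous.
by apply/funext => x /=; case: (f x).
Qed.

(** The constant 2 comes from bounding the real and the imaginary part of the
    integral separately; any constant would do. *)
Lemma cint_cauchy_schwarz u v (a b : R) : cmeasurable u -> cmeasurable v ->
  (L2norm u <= a%:E)%E -> (L2norm v <= b%:E)%E ->
  normc (cint (fun x => u x * v x)) <= 2 * (a * b).
Proof.
move=> mu_ mv ua vb.
have nu := measurable_normc mu_; have nv := measurable_normc mv.
have H : (\int[mu]_x (`|normc (u x) * normc (v x)|)%:E <= (a * b)%:E)%E.
  have := @hoelder _ _ _ mu (fun x => normc (u x)) (fun x => normc (v x)) 2 2 nu nv.
  have -> : (2^-1 + 2^-1 = 1 :> R)%R by lra.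
  move=> /(_ (ltr0Sn _ _) (ltr0Sn _ _) erefl); rewrite Lnorm1 => h.
  apply: le_trans h _; rewrite EFinM; apply: lee_pmul => //; exact: Lnorm_ge0.
have [m1 m2] := cmeasurableM mu_ mv.
have aux (h : R -> R) : measurable_fun setT h ->
    (forall x, `|h x| <= normc (u x * v x)) -> `|\int[mu]_x h x| <= a * b.
  move=> mh hh.
  have le : (\int[mu]_x `|(h x)%:E| <= (a * b)%:E)%E.
    apply: le_trans H; apply: ge0_le_integral => //.
    - exact/measurable_EFinP/measurableT_comp.
    - apply/measurable_EFinP; apply: measurableT_comp => //; exact: measurable_funM.
    - move=> x _; rewrite lee_fin; apply: le_trans (hh x) _.
      by rewrite ComplexField.Normc.normcM ler_norm.
  have ih : mu.-integrable setT (EFin \o h).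
    apply/integrableP; split; first exact/measurable_EFinP.
    by apply: le_lt_trans le _; rewrite ltry.
  by rewrite -lee_fin EFin_normr_Rintegral //; apply: le_trans (le_abse_integral _ _ _) le;
    [exact: measurableT|case/integrableP: ih].
apply: le_trans (normc_le_ReIm _) _; rewrite mulr_natl mulr2n lerD //.
  by apply: aux m1 _ => x; apply: Re_le_normc.
by apply: aux m2 _ => x; apply: Im_le_normc.
Qed.

(** An imaginary [s] does not change the modulus of the Gaussian, so one bound
    serves all windows. *)
Lemma L2norm_cgauss_bound (p : R[i]) : 0 < Rec p ->
  exists2 b : R, 0 < b & forall s, Rec s = 0 -> (L2norm (cgauss p s) <= b%:E)%E.
Proof.
move=> p0.
have E s : Rec s = 0 -> L2norm (cgauss p s) = L2norm (cgauss p 0).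
  move=> s0; rewrite /L2norm; apply: eq_Lnorm => x; rewrite /comp.
  by rewrite !normc_cgauss s0.
have fin : (L2norm (cgauss p 0%R) < +oo)%E.
  rewrite /L2norm (_ : (fun x => _) = (fun x => expR (- Rec p * x ^+ 2))); last first.
    by apply/funext => x; rewrite normc_cgauss mul0r sub0r mulNr.
  rewrite unlock; apply: poweR_lty.
  rewrite (_ : (fun x => _) = EFin \o (fun x => expR (- (2 * Rec p) * x ^+ 2))); last first.
    apply/funext => x /=; rewrite ger0_norm ?expR_ge0 //.
    rewrite powR_mulrn ?expR_ge0 // -expRM_natl; congr (expR _)%:E; ring.
  have p20 : 0 < 2 * Rec p by rewrite mulr_gt0.
  have /integrableP[_] := integrable_expR_sqr p20.
  move=> h; apply: le_lt_trans h; rewrite le_eqVlt; apply/orP; left; apply/eqP.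
  by apply: eq_integral => x _; rewrite /= ger0_norm ?expR_ge0.
have [r hr] : exists r : R, L2norm (cgauss p 0) = r%:E.
  have := Lnorm_ge0 mu 2%:E (EFin \o (fun x => normc (cgauss p 0 x))).
  rewrite -/(L2norm _); case: (L2norm _) fin => [r _ _|//|//].
  by exists r.
exists (`|r| + 1) => [|s s0]; first by rewrite ltr_wpDl.
by rewrite E // hr lee_fin; apply: le_trans (ler_norm _) _; rewrite lerDl.
Qed.

End Pairing.

(** * A geometric sum and complex inverses *)

Section SmallFacts.
Variable R : realType.

Lemma sum_expR_dist_bounded (r : R) : 0 <= r < 1 -> forall N : nat,
  \sum_(j < N.*2.+1) r ^+ `|j - N|%N <= 2 / (1 - r).
Proof.
move=> /andP[r0 r1] N.
have G n : \sum_(i < n) r ^+ i <= (1 - r)^-1.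
  have r1' : 0 < 1 - r by rewrite subr_gt0.
  rewrite -(ler_pM2l r1') divff ?gt_eqF // -opprB mulNr -subrX1 opprB.
  by rewrite gerBl exprn_ge0.
rewrite -addnn -addnS big_split_ord /= mulr_natl mulr2n lerD //.
  rewrite (reindex_inj rev_ord_inj) /=.
  apply: le_trans (_ : r * \sum_(i < N) r ^+ i <= _).
    rewrite mulr_sumr le_eqVlt; apply/orP; left; apply/eqP.
    apply: eq_bigr => i _; rewrite -exprS; congr (_ ^+ _).
    by have := ltn_ord i; lia.
  by apply: le_trans (G N); rewrite ler_piMl ?sumr_ge0 ?ltW // => i _;
    rewrite exprn_ge0 // ltW.
apply: le_trans (G N.+1); rewrite le_eqVlt; apply/orP; left; apply/eqP.
by apply: eq_bigr => i _; congr (_ ^+ _); lia.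
Qed.

Lemma RecV (z : R[i]) : Rec z^-1 = Rec z / (Rec z ^+ 2 + Imc z ^+ 2).
Proof. by case: z. Qed.

Lemma ImcV (z : R[i]) : Imc z^-1 = - (Imc z / (Rec z ^+ 2 + Imc z ^+ 2)).
Proof. by case: z. Qed.

End SmallFacts.



(** * The theta functional *)

Section Core.
Variable R : realType.
Variables a1 b1 a2 b2 : R.
Hypothesis a1_neq0 : a1 != 0.
Let D := a1 * b2 - a2 * b1.
Hypothesis D_gt1 : 1 < D.

(** The complex coordinate in which the Gaussian pairings become exponentials:
    [exp (s x - x^2)] with [s = phase a b] is a scalar multiple of the
    time-frequency shift of the Gaussian. *)
Definition phase (a b : R) : R[i] := (2 * a) +i* (2 * pi * b).
Let I2pi : R[i] := 0 +i* (2 * pi).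
Let w : R[i] := I2pi * phase a2 b2 / phase a1 b1.
Let t (a b : R) : R[i] := I2pi * phase a b / phase a1 b1.
(** Any value strictly between 0 and [D - 1] gives a window of finite norm and
    summable weights. *)
Let kappa : R := (D - 1) / 2.
Let p : R[i] := (1 + kappa) +i* ((1 + kappa) * pi * b1 / a1).
(** The chirp makes [p = 1 + alpha] a real multiple of [phase a1 b1], which is
    what renders [beta] imaginary. *)
Let alpha : R[i] := kappa +i* ((1 + kappa) * pi * b1 / a1).
Let beta : R[i] := 0 +i* (2 * pi * (1 + kappa) / a1).
Let gamma : R[i] := beta ^+ 2 / (4 * p).
Let n2 : R := (2 * a1) ^+ 2 + (2 * pi * b1) ^+ 2.

Let kappa_gt0 : 0 < kappa.
Proof. by rewrite /kappa divr_gt0 // subr_gt0. Qed.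

Let Re_p_gt0 : 0 < Rec p.
Proof. by rewrite /= addr_gt0. Qed.

Let p_neq0 : p != 0.
Proof. by apply/eqP => h; move: Re_p_gt0; rewrite h ltxx. Qed.

Let n2_gt0 : 0 < n2.
Proof. by rewrite ltr_pwDl ?sqr_ge0 // lt_def sqrf_eq0 mulf_neq0 //= ?pnatr_eq0 // sqr_ge0. Qed.

Let phase1_neq0 : phase a1 b1 != 0.
Proof.
apply/eqP => /(congr1 (@complex.Re _)) /= /eqP; rewrite mulf_eq0 (negbTE a1_neq0).
by rewrite pnatr_eq0.
Qed.

Let I2pi_neq0 : I2pi != 0.
Proof.
apply/eqP => /(congr1 (@complex.Im _)) /= /eqP; rewrite mulf_eq0 pnatr_eq0 /=.
by rewrite gt_eqF // pi_gt0.
Qed.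

(** This is what [beta] is chosen for: the exponent linear in [k] becomes [t],
    which grows by [2 pi i] along the first basis vector. *)
Let beta_eq : beta / (2 * p) = I2pi / phase a1 b1.
Proof.
have two0 : (2 : R[i]) != 0 by rewrite pnatr_eq0.
apply/eqP; rewrite eqr_div ?mulf_neq0 //; apply/eqP.
rewrite /beta /I2pi /p /phase; apply: complex_ext; rewrite !cE /=; field.
  exact: a1_neq0.
exact: a1_neq0.
Qed.

(** The imaginary part of [phase a2 b2 / phase a1 b1] is positive because the
    basis is positively oriented. *)
Let Re_w : Rec w = - (2 * pi ^+ 2 * 4 * D / n2).
Proof.
rewrite /w /I2pi /phase !cE RecV ImcV /= -/n2 /D; field.
by rewrite gt_eqF.
Qed.

Let Re_gamma : Rec gamma = - (4 * pi ^+ 2 * (1 + kappa) / n2).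
Proof.
have two0 : (2 : R[i]) != 0 by rewrite pnatr_eq0.
have -> : gamma = beta * (I2pi / phase a1 b1) / 2.
  by rewrite -beta_eq /gamma; field; rewrite p_neq0.
have -> : 2^-1 = (2^-1)%:C :> R[i] by rewrite fmorphV rmorph_nat.
rewrite !cE RecV ImcV /= -/n2; field.
by rewrite a1_neq0 gt_eqF.
Qed.

Lemma normc_cexp_w_lt1 : normc (cexp w) < 1.
Proof.
rewrite normc_cexp Re_w expR_lt1 oppr_lt0 divr_gt0 // !mulr_gt0 ?exprn_gt0 ?pi_gt0 //.
exact: lt_trans ltr01 D_gt1.
Qed.

Lemma tf_shift_gaussianE a b x :
  tf_shift a b (@gaussian R) x = cexp (- (a ^+ 2)%:C) * cgauss 1 (phase a b) x.
Proof.
rewrite /tf_shift /gaussian /cgauss -cexpD.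
apply: complex_ext; rewrite !cE ?Re_cexp ?Im_cexp !cE /=.
  rewrite mulr0 subr0 mulrC; congr (expR _ * cos _); ring.
rewrite mulr0 add0r mulrC; congr (expR _ * sin _); ring.
Qed.

Definition window (k : R) : R -> R[i] := cgauss alpha (k%:C * beta).

Lemma tf_windowE a b k x : tf_shift a b (@gaussian R) x * window k x =
  cexp (- (a ^+ 2)%:C) * cgauss p (phase a b + k%:C * beta) x.
Proof.
rewrite tf_shift_gaussianE /window /cgauss -!cexpD; congr cexp.
have -> : p = 1 + alpha by apply: complex_ext; rewrite !cE /= ?add0r.
ring.
Qed.

Lemma cgauss_ccontinuous (q s : R[i]) : ccontinuous (cgauss q s).
Proof. by apply: cderive_continuous => x; apply: cgauss_cderive. Qed.

Lemma cgauss_cintegrable (q s : R[i]) : 0 < Rec q -> cintegrable (cgauss q s).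
Proof.
move=> q0; rewrite (_ : cgauss q s = fun x => cquad 1 0 0 x * cgauss q s x).
  exact: cquad_gauss_cintegrable.
by apply/funext => x; rewrite /cquad !mul0r !addr0 mul1r.
Qed.

Lemma tf_window_cintegrable a b k :
  cintegrable (fun x => tf_shift a b (@gaussian R) x * window k x).
Proof.
rewrite (_ : (fun x => _) = fun x => cexp (- (a ^+ 2)%:C) *
  cgauss p (phase a b + k%:C * beta) x); last by apply/funext => x; rewrite tf_windowE.
by apply: cintegrableZ; apply: cgauss_cintegrable.
Qed.

Lemma tf_cmeasurable a b : cmeasurable (tf_shift a b (@gaussian R)).
Proof.
rewrite (_ : tf_shift a b _ = fun x => cexp (- (a ^+ 2)%:C) * cgauss 1 (phase a b) x).
  apply: cmeasurableM; first exact: cmeasurable_cst.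
  exact/ccontinuous_measurable/cgauss_ccontinuous.
by apply/funext => x; rewrite tf_shift_gaussianE.
Qed.

(** The part of the pairing that does not depend on the window. *)
Definition gauss_factor (a b : R) : R[i] :=
  cexp (- (a ^+ 2)%:C) * cint (cgauss p 0) * cexp (phase a b ^+ 2 / (4 * p)).

Lemma gauss_factor_neq0 a b : gauss_factor a b != 0.
Proof.
have := gmoment_neq0 Re_p_gt0.
rewrite (_ : gmoment _ _ _ _ _ = cint (cgauss p 0)) => [h|].
  by rewrite !mulf_neq0 ?cexp_neq0.
by apply: eq_cint => x; rewrite /cquad !mul0r !addr0 mul1r.
Qed.

Lemma cint_tf_window a b k :
  cint (fun x => tf_shift a b (@gaussian R) x * window k x) =
  gauss_factor a b * cexp (k%:C * t a b + (k%:C) ^+ 2 * gamma).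
Proof.
rewrite (_ : (fun x => _) = fun x => cexp (- (a ^+ 2)%:C) *
  cgauss p (phase a b + k%:C * beta) x); last by apply/funext => x; rewrite tf_windowE.
rewrite cintZ; last exact: cgauss_cintegrable.
rewrite gaussian_integral // /gauss_factor -!mulrA; congr (_ * (_ * _)).
rewrite -cexpD; congr cexp; rewrite /t /gamma mulrAC -beta_eq.
by field; rewrite p_neq0.
Qed.

(** The coefficients of the triple product, corrected by the factor
    [exp (- k^2 gamma)] that cancels the quadratic exponent of the Gaussian
    pairing. *)
Definition theta_coef (N j : nat) : R[i] :=
  let k : R[i] := j%:R - N%:R in
  (-1) ^+ (N + j) * qbin (cexp w) N.*2 j *
  cexp (k * (k - 1) / 2 * w - k ^+ 2 * gamma).

Definition theta_pairing (N : nat) (f : R -> R[i]) : R[i] :=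
  \sum_(j < N.*2.+1) theta_coef N j * cint (fun x => f x * window (j%:R - N%:R) x).

Lemma pairing_tf N a b :
  theta_pairing N (tf_shift a b (@gaussian R)) = gauss_factor a b *
  (\prod_(m < N) (1 - cexp w ^+ m * cexp (t a b)) *
   \prod_(m < N) (1 - cexp w ^+ m * cexp (w - t a b))).
Proof.
rewrite -finite_jacobi_triple_product mulr_sumr; apply: eq_bigr => j _ /=.
rewrite cint_tf_window /theta_coef rmorphB !rmorph_nat.
set k : R[i] := j%:R - N%:R.
set e := cexp (_ - k ^+ 2 * gamma); set e' := cexp (_ + k ^+ 2 * gamma).
rewrite (_ : cexp (k * (k - 1) / 2 * w + k * t a b) = e * e'); first ring.
by rewrite -cexpD; congr cexp; ring.
Qed.

Lemma t_lattice (m n : int) a b : a = m%:~R * a1 + n%:~R * a2 ->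
  b = m%:~R * b1 + n%:~R * b2 -> t a b = m%:~R * I2pi + n%:~R * w.
Proof.
move=> -> ->; rewrite /t /w.
have -> : phase (m%:~R * a1 + n%:~R * a2) (m%:~R * b1 + n%:~R * b2) =
   m%:~R * phase a1 b1 + n%:~R * phase a2 b2.
  have E (k : int) : k%:~R = (k%:~R)%:C :> R[i] by rewrite rmorph_int.
  by rewrite !E /phase; apply: complex_ext; rewrite !cE /=; ring.
by field.
Qed.

Lemma cexp_int_2pi (m : int) : cexp (m%:~R * I2pi) = 1.
Proof.
rewrite (_ : _ * _ = 0 +i* (2 * pi * m%:~R)) ?cexp_2piZ //.
have E : m%:~R = (m%:~R)%:C :> R[i] by rewrite rmorph_int.
by rewrite E /I2pi; apply: complex_ext; rewrite !cE /=; ring.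
Qed.

(** At [m] times the first plus [n] times the second basis vector
    [exp t = q^n], so the factor of index [- n] of the first product vanishes
    if [n <= 0], and the one of index [n - 1] of the second product if
    [n > 0]. *)
Lemma pairing_lattice (m n : int) a b N : a = m%:~R * a1 + n%:~R * a2 ->
  b = m%:~R * b1 + n%:~R * b2 -> (`|n| < N)%N ->
  theta_pairing N (tf_shift a b (@gaussian R)) = 0.
Proof.
move=> ha hb nN; rewrite pairing_tf (t_lattice ha hb).
case: n nN {ha hb} => [[|n]|n] nN.
- have N0 : (0 < N)%N by lia.
  rewrite (bigD1 (Ordinal N0)) //= expr0 mul1r mulr0z mul0r addr0 cexp_int_2pi subrr.
  by rewrite !mul0r mulr0.
- have n0 : (n < N)%N by lia.
  rewrite [X in _ * (_ * X)](bigD1 (Ordinal n0)) //= cexp_natM -cexpD.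
  rewrite (_ : n%:R * w + _ = (- m)%:~R * I2pi).
    by rewrite cexp_int_2pi subrr !mul0r !mulr0.
  by rewrite -pmulrn -[n.+1%:R]natr1 mulrNz; ring.
have n0 : (n.+1 < N)%N by lia.
rewrite (bigD1 (Ordinal n0)) //= cexp_natM -cexpD.
rewrite (_ : n.+1%:R * w + _ = m%:~R * I2pi).
  by rewrite cexp_int_2pi subrr !mul0r mulr0.
by rewrite NegzE mulrNz -pmulrn; ring.
Qed.

Lemma phase_inj a b (m n : int) :
  phase a b = m%:~R * phase a1 b1 + n%:~R * phase a2 b2 ->
  a = m%:~R * a1 + n%:~R * a2 /\ b = m%:~R * b1 + n%:~R * b2.
Proof.
have E (k : int) : k%:~R = (k%:~R)%:C :> R[i] by rewrite rmorph_int.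
rewrite !E => h; split.
  have := congr1 (@complex.Re _) h; rewrite !cE /= => h'; lra.
have := congr1 (@complex.Im _) h; rewrite !cE /= => h'.
apply: (mulfI (_ : 2 * pi != 0)); first by rewrite gt_eqF // mulr_gt0 // pi_gt0.
rewrite h'; ring.
Qed.

(** A factor of one of the two products vanishes only if [phase a b] is an
    integral combination of [phase a1 b1] and [phase a2 b2]. *)
Lemma pairing_lower_bound a b :
  (forall m n : int,
    ~ (a = m%:~R * a1 + n%:~R * a2 /\ b = m%:~R * b1 + n%:~R * b2)) ->
  exists2 c : R, 0 < c &
    forall N, c <= normc (theta_pairing N (tf_shift a b (@gaussian R))).
Proof.
move=> nL.
have tE : t a b * phase a1 b1 = I2pi * phase a b by rewrite /t divfK.
have wE : w * phase a1 b1 = I2pi * phase a2 b2 by rewrite /w divfK.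
(* An integral relation between w, t and 2 pi i puts (a, b) on the lattice. *)
have key (l : int) (n : int) : l%:~R * w + t a b = n%:~R * I2pi -> False.
  move=> h; apply: (nL n (- l)); apply: phase_inj.
  apply: (mulfI I2pi_neq0); rewrite -tE.
  have -> : t a b = n%:~R * I2pi - l%:~R * w by rewrite -h addrC addKr.
  rewrite mulrBl -mulrA -mulrA wE mulrNz; ring.
have cexp1 z : cexp z = 1 -> exists n : int, z = n%:~R * I2pi.
  move=> /cexp_eq1[n ->]; exists n.
  have E : n%:~R = (n%:~R)%:C :> R[i] by rewrite rmorph_int.
  by rewrite E /I2pi; apply: complex_ext; rewrite !cE /=; ring.
have [|m|c1 c10 hc1] := @qprod_lower_bound R (cexp w) (cexp (t a b)).
- exact: normc_cexp_w_lt1.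
- rewrite subr_eq0 eq_sym; apply/eqP; rewrite cexp_natM -cexpD => /cexp1[n h].
  by apply: (key m n); rewrite -pmulrn; exact: h.
have [|m|c2 c20 hc2] := @qprod_lower_bound R (cexp w) (cexp (w - t a b)).
- exact: normc_cexp_w_lt1.
- rewrite subr_eq0 eq_sym; apply/eqP; rewrite cexp_natM -cexpD => /cexp1[n h].
  apply: (key (- m.+1%:Z) (- n)); rewrite !mulrNz -pmulrn -[m.+1%:R]natr1.
  by rewrite [RHS]mulNr -h; ring.
exists (normc (gauss_factor a b) * (c1 * c2)) => [|N].
  rewrite !mulr_gt0 // lt_def normc_ge0 andbT.
  apply/eqP => /ComplexField.Normc.eq0_normc /eqP.
  by apply/negP; apply: gauss_factor_neq0.
rewrite pairing_tf (ComplexField.Normc.normcM (gauss_factor a b)) ler_wpM2l ?normc_ge0 //.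
rewrite ComplexField.Normc.normcM.
exact: ler_pM (ltW c10) (ltW c20) (hc1 N) (hc2 N).
Qed.

(** The real part of the exponent is [E0 (- kappa k^2 + D k)] with [E0 > 0];
    completing the square bounds it by a constant minus [|k|], which leaves a
    geometric series. *)
Lemma theta_coef_sum_bounded : exists2 M : R, 0 < M &
  forall N, \sum_(j < N.*2.+1) normc (theta_coef N j) <= M.
Proof.
have [B B0 hB] := qbin_bounded normc_cexp_w_lt1.
pose E0 := 4 * pi ^+ 2 / n2.
have E00 : 0 < E0 by rewrite divr_gt0 // mulr_gt0 // exprn_gt0 // pi_gt0.
pose C := (E0 * D + 1) ^+ 2 / (4 * (E0 * kappa)).
pose r := expR (-1 : R).
have r01 : 0 <= r < 1 by rewrite expR_ge0 expR_lt1 oppr_lt0 ltr01.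
have r1 : 0 < 1 - r by rewrite subr_gt0; case/andP: r01.
exists (B * expR C * (2 / (1 - r))) => [|N].
  by rewrite !mulr_gt0 ?expR_gt0 ?invr_gt0.
apply: le_trans (_ : \sum_(j < N.*2.+1) B * expR C * r ^+ `|j - N|%N <= _); last first.
  rewrite -mulr_sumr ler_wpM2l ?mulr_ge0 ?expR_ge0 ?(ltW B0) //.
  exact: sum_expR_dist_bounded.
apply: ler_sum => j _; rewrite /theta_coef !ComplexField.Normc.normcM normcX.
rewrite normcN ComplexField.Normc.normc1 expr1n mul1r -[leRHS]mulrA.
apply: ler_pM; rewrite ?normc_ge0 ?hB //.
pose k : R := j%:R - N%:R.
have -> : j%:R - N%:R = k%:C :> R[i] by rewrite rmorphB !rmorph_nat.
have kE : `|j - N|%N%:R = `|k|.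
  rewrite /k; case: (leqP N j) => h.
    by rewrite distnEl // natrB // ger0_norm // subr_ge0 ler_nat.
  rewrite distnEr ?(ltnW h) // natrB ?(ltnW h) // ler0_norm ?opprB //.
  by rewrite subr_le0 ler_nat ltnW.
rewrite normc_cexp /r -expRM_natl -expRD ler_expR kE.
have -> : k%:C * (k%:C - 1) / 2 * w - k%:C ^+ 2 * gamma =
  (k * (k - 1) / 2)%:C * w - (k ^+ 2)%:C * gamma.
  clearbody k; by rewrite !rmorphM rmorphB rmorph1 fmorphV rmorph_nat.
rewrite RecD RecN (RecM _ w) (RecM _ gamma) Re_w Re_gamma ![Imc _%:C]/= !mul0r !subr0 /=.
have -> : k * (k - 1) / 2 * - (2 * pi ^+ 2 * 4 * D / n2) -
   k ^+ 2 * - (4 * pi ^+ 2 * (1 + kappa) / n2) = - (E0 * kappa) * k ^+ 2 + E0 * D * k.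
  by rewrite /E0 /kappa; field; rewrite gt_eqF.
have Ek : 0 < E0 * kappa by rewrite mulr_gt0.
have : 0 <= (2 * (E0 * kappa) * `|k| - (E0 * D + 1)) ^+ 2 / (4 * (E0 * kappa)).
  by rewrite divr_ge0 ?sqr_ge0 // mulr_ge0 // ltW.
have -> : (2 * (E0 * kappa) * `|k| - (E0 * D + 1)) ^+ 2 / (4 * (E0 * kappa)) =
   C - (E0 * D + 1) * `|k| + E0 * kappa * k ^+ 2.
  rewrite /C -(@real_normK _ k) ?num_real //; field.
  by rewrite !gt_eqF.
have : E0 * D * k <= E0 * D * `|k|.
  by rewrite ler_wpM2l ?ler_norm // mulr_ge0 // ltW // (lt_trans ltr01).
lra.
Qed.

Lemma pairing_bounded : exists2 M : R, 0 < M &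
  forall N u (eps : R), 0 <= eps -> cmeasurable u -> (L2norm u <= eps%:E)%E ->
  normc (theta_pairing N u) <= M * eps.
Proof.
have [M M0 hM] := theta_coef_sum_bounded.
have [b b0 hb] := @L2norm_cgauss_bound R alpha kappa_gt0.
exists (M * (2 * b)) => [|N u eps eps0 mu_ ue]; first by rewrite !mulr_gt0.
apply: le_trans (normc_sum _ _ _) _.
apply: le_trans (_ : \sum_(j < N.*2.+1) normc (theta_coef N j) * (2 * (eps * b)) <= _).
  apply: ler_sum => j _; rewrite ComplexField.Normc.normcM ler_wpM2l ?normc_ge0 //.
  apply: cint_cauchy_schwarz => //.
    exact/ccontinuous_measurable/cgauss_ccontinuous.
  by apply: hb; rewrite !cE /= mul0r mulr0 subr0.
rewrite -mulr_suml -!mulrA (mulrC b) ler_wpM2r ?mulr_ge0 // ltW //.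
Qed.

Lemma pairing_sub_sum N a b n (c : 'I_n -> R[i]) (phi : 'I_n -> R -> R[i])
    (ab : 'I_n -> R * R) :
  (forall k, phi k = tf_shift (ab k).1 (ab k).2 (@gaussian R)) ->
  theta_pairing N (tf_shift a b (@gaussian R) \-
    (fun x => \sum_(k < n) c k * phi k x)) =
  theta_pairing N (tf_shift a b (@gaussian R)) -
    \sum_(k < n) c k * theta_pairing N (phi k).
Proof.
move=> hphi.
have L (k : R) : cint (fun x => (tf_shift a b (@gaussian R) \-
      (fun x => \sum_(k < n) c k * phi k x)) x * window k x) =
    cint (fun x => tf_shift a b (@gaussian R) x * window k x) -
    \sum_(i < n) c i * cint (fun x => phi i x * window k x).
  have I i : cintegrable (fun x => phi i x * window k x).
    by rewrite hphi; apply: tf_window_cintegrable.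
  have [s1 s2] := @cint_sum R n (fun i x => - c i * (phi i x * window k x))
     (fun i => cintegrableZ _ (I i)).
  rewrite (_ : (fun x => _) = fun x => tf_shift a b (@gaussian R) x * window k x +
     \sum_(i < n) - c i * (phi i x * window k x)).
    rewrite cintD //; last exact: tf_window_cintegrable.
    rewrite s2; congr (_ + _); rewrite -sumrN; apply: eq_bigr => i _.
    by rewrite cintZ // mulNr.
  apply/funext => x /=; rewrite mulrBl; congr (_ + _).
  by rewrite mulr_suml -sumrN; apply: eq_bigr => i _; rewrite mulNr mulrA.
rewrite /theta_pairing; under eq_bigr => j _ do rewrite L mulrBr.
rewrite sumrB; congr (_ - _).
under eq_bigr => j _ do rewrite mulr_sumr.
rewrite exchange_big /=; apply: eq_bigr => i _; rewrite mulr_sumr.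
by apply: eq_bigr => j _; rewrite mulrCA.
Qed.

(** An approximant at distance [eps] is killed by the functional for large
    [N], whence [c <= M eps]; this fails for [eps = c / (2 M)]. *)
Lemma gabor_not_mem (L : set 'cV[R]_2) (v : 'cV[R]_2) :
  (forall u : 'cV[R]_2, L u <-> exists m n : int,
     u 0 0 = m%:~R * a1 + n%:~R * a2 /\ u 1 0 = m%:~R * b1 + n%:~R * b2) ->
  ~ L v -> ~ gabor_space (@gaussian R) L (tf_shift (v 0 0) (v 1 0) (@gaussian R)).
Proof.
move=> hL nLv [_ approx].
have [c c0 hc] : exists2 c : R, 0 < c & forall N,
    c <= normc (theta_pairing N (tf_shift (v 0 0) (v 1 0) (@gaussian R))).
  apply: pairing_lower_bound => m n h; apply: nLv; apply/hL.
  by exists m, n.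
have [M M0 hM] := pairing_bounded.
pose eps := c / (2 * M).
have eps0 : 0 < eps by rewrite divr_gt0 // mulr_gt0.
have [h [n [d [phi [hphi ->]]]] dist] := approx _ eps0.
have {hphi} /choice[u hu] : forall k : 'I_n, exists u : R * R * (int * int),
   [/\ phi k = tf_shift u.1.1 u.1.2 (@gaussian R),
    u.1.1 = u.2.1%:~R * a1 + u.2.2%:~R * a2 & u.1.2 = u.2.1%:~R * b1 + u.2.2%:~R * b2].
  move=> k; have [z /hL[m [l [h1 h2]]] <-] := hphi k.
  by exists ((z 0 0, z 1 0), (m, l)).
(* N exceeds the second coordinate of every lattice point in the combination. *)
pose N := (\max_(k < n) `|(u k).2.2|%N).+1.
have fphi k : theta_pairing N (phi k) = 0.
  have [-> h1 h2] := hu k; apply: (pairing_lattice h1 h2).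
  by rewrite ltnS; apply: (@leq_bigmax _ (fun k => `|(u k).2.2|%N)).
have mphi k : cmeasurable (phi k).
  by have [-> _ _] := hu k; apply: tf_cmeasurable.
have md : cmeasurable (tf_shift (v 0 0) (v 1 0) (@gaussian R) \-
    (fun x => \sum_(k < n) d k * phi k x)).
  rewrite (_ : _ \- _ = fun x => tf_shift (v 0 0) (v 1 0) (@gaussian R) x +
     (-1) * (\sum_(k < n) d k * phi k x)).
    apply: cmeasurableD; first exact: tf_cmeasurable.
    apply: cmeasurableM; first exact: cmeasurable_cst.
    apply: cmeasurable_sum => k; apply: cmeasurableM => //; exact: cmeasurable_cst.
  by apply/funext => x /=; rewrite mulN1r.
have := hM N _ _ (ltW eps0) md (ltW dist).
rewrite (@pairing_sub_sum N _ _ n d phi (fun k => (u k).1)); last first.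
  by move=> k; have [] := hu k.
rewrite [X in _ - X]big1 ?subr0; last by move=> k _; rewrite fphi mulr0.
move/(le_trans (hc N)); rewrite /eps.
rewrite (_ : M * (c / (2 * M)) = c / 2); last by field; rewrite gt_eqF.
lra.
Qed.

End Core.

(** * The theorem *)

Lemma det_mx22 (A : comNzRingType) (M : 'M[A]_2) :
  \det M = M 0 0 * M 1 1 - M 0 1 * M 1 0.
Proof.
rewrite (expand_det_row _ ord0) !big_ord_recl big_ord0 addr0 /cofactor !det_mx11 !mxE /=.
rewrite expr0 expr1 mul1r mulN1r mulrN.
by congr (M _ _ * M _ _ - M _ _ * M _ _); apply: val_inj.
Qed.

(** Membership in terms of the two columns, the form in which a basis can be
    reordered and its orientation reversed. *)
Lemma latticeP (R : realType) (A : 'M[R]_2) (u : 'cV[R]_2) :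
  lattice A u <-> exists m n : int,
    u 0 0 = m%:~R * A 0 0 + n%:~R * A 0 1 /\ u 1 0 = m%:~R * A 1 0 + n%:~R * A 1 1.
Proof.
have E (z : 'cV[int]_2) i : (A *m map_mx intr z) i 0 =
    (z 0 0)%:~R * A i 0 + (z 1 0)%:~R * A i 1.
  rewrite mxE !big_ord_recl big_ord0 addr0 !mxE [LHS]addrC addrC mulrC.
  congr (_ + _); rewrite mulrC.
  by congr ((z _ _)%:~R * A _ _); apply: val_inj.
split=> [[z _ <-]|[m [n [h0 h1]]]].
  by exists (z 0 0), (z 1 0); rewrite !E.
exists (\col_i (if i == 0 then m else n)) => //.
apply/matrixP => i j; rewrite (ord1 j) E !mxE /=.
case: (unliftP 0 i) => [k ->|->]; last by rewrite h0.
by rewrite (ord1 k) (_ : lift _ _ = 1) ?h1 //; apply: val_inj.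
Qed.

Theorem corollary1p6 (R : realType) (A : 'M[R]_2) (A_unit : A \in unitmx)
    (density_rat : exists q : rat, density A = ratr q)
    (density_lt1 : density A < 1)
    (w : 'cV[R]_2) (w_notin : ~ lattice A w) :
  ~ gabor_space (@gaussian R) (lattice A)
      (tf_shift (w 0 0) (w 1 0) (@gaussian R)).
Proof.
have detD := det_mx22 A.
have det_gt1 : 1 < `|A 0 0 * A 1 1 - A 0 1 * A 1 0|.
  have d0 : 0 < `|\det A|.
    by rewrite normr_gt0; move: A_unit; rewrite unitmxE unitfE.
  by move: density_lt1; rewrite /density invf_lt1 // detD.
(* The first basis vector must have a nonzero time coordinate, and the basis
   must be positively oriented: exchange the columns or negate one of them. *)
have [a0|a0] := eqVneq (A 0 0) 0.
  have a1 : A 0 1 != 0.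
    apply/eqP => h; move: det_gt1; rewrite a0 h !mul0r subrr normr0.
    by rewrite ltNge ler01.
  have [d|d] := leP 0 (A 0 0 * A 1 1 - A 0 1 * A 1 0).
    rewrite ger0_norm // in det_gt1.
    apply: (@gabor_not_mem R (A 0 1) (A 1 1) (- A 0 0) (- A 1 0)) => // [|u].
      by rewrite mulrN mulNr; lra.
    rewrite latticeP; split=> -[m [n [h0 h1]]].
      by exists n, (- m); rewrite h0 h1 !mulrNz; split; ring.
    by exists (- n), m; rewrite h0 h1 !mulrNz; split; ring.
  rewrite ltr0_norm // in det_gt1.
  apply: (@gabor_not_mem R (A 0 1) (A 1 1) (A 0 0) (A 1 0)) => // [|u]; first lra.
  rewrite latticeP; split=> -[m [n [h0 h1]]].
    by exists n, m; rewrite h0 h1 !(addrC (n%:~R * _)).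
  by exists n, m; rewrite h0 h1 !(addrC (n%:~R * _)).
have [d|d] := leP 0 (A 0 0 * A 1 1 - A 0 1 * A 1 0).
  rewrite ger0_norm // in det_gt1.
  apply: (@gabor_not_mem R (A 0 0) (A 1 0) (A 0 1) (A 1 1)) => // u.
  exact: latticeP.
rewrite ltr0_norm // in det_gt1.
apply: (@gabor_not_mem R (A 0 0) (A 1 0) (- A 0 1) (- A 1 1)) => // [|u].
  by rewrite mulrN mulNr; lra.
rewrite latticeP; split=> -[m [n [h0 h1]]].
  by exists m, (- n); rewrite h0 h1 !mulrNz; split; ring.
by exists m, (- n); rewrite h0 h1 !mulrNz; split; ring.
Qed.
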